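(* In the setting of the context, fix $\theta^t\in\mathbb{R}^D$ and let $\hat g^{\mathcal E}_t$ be the gate-noise-affected parameter-shift gradient estimator at $\theta^t$, decomposed as $\hat g^{\mathcal E}_t=g_t+(g^{\mathcal E}_t-g_t)+\xi^{\mathcal E}_t$, where $g_t=\nabla L(\theta^t)$, $g^{\mathcal E}_t=\mathbb{E}[\hat g^{\mathcal E}_t]$, and $\mathrm{bias}=g^{\mathcal E}_t-g_t$. Let $\gamma=1-(1-\epsilon)^D$. Then $$\mathrm{var}(\xi^{\mathcal E}_t):=\mathbb{E}\|\hat g_t^{\mathcal E}-g_t^{\mathcal E}\|^2\le\frac{DN_h\operatorname{Tr}(H^2)}{2N_m}\,c(\gamma),$$ where $c(\gamma)=\max_{y\in\{1,\dots,N_h\}}\max_{\theta\in\mathbb{R}^D}\nu(p^{\mathcal E}(y|\theta))$, with $$\nu(p^{\mathcal E}(y|\theta))=\gamma\,\nu(\tilde p(y|\theta))+\nu(1-\gamma)\,\bigl(p(y|\theta)-\tilde p(y|\theta)\bigr)^2+(1-\gamma)\,\nu(p(y|\theta))$$ for all $y$ and $\theta$. Furthermore, $$\|\mathrm{bias}\|^2\le4D\|H\|_\infty^2\,\gamma.$$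
   Context: Circuit. Fix $n$ qubits and $D\ge1$ parameters $\theta=(\theta_1,\dots,\theta_D)\in\mathbb{R}^D$. For each $d$, $U_d(\theta_d)=\exp(-i\frac{\theta_d}{2}G_d)$ with $G_d\in\{I,X,Y,Z\}^{\otimes n}$ a Pauli string, and $V_d$ is a fixed unitary. The noiseless gate $d$ is the channel $\mathcal U_d^{\theta_d}(\rho)=W_d\rho W_d^\dagger$ with $W_d=U_d(\theta_d)V_d$, and $|\Psi(\theta)\rangle=W_D\cdots W_1|0\rangle$, $\Psi(\theta)=|\Psi(\theta)\rangle\langle\Psi(\theta)|$. Observable and loss. $H=\sum_{y=1}^{N_h}h_y\Pi_y$ is a Hermitian matrix with $N_h\le2^n$ distinct eigenvalues $h_y$ and eigenprojections $\Pi_y$; $L(\theta)=\operatorname{Tr}(H\Psi(\theta))$; $\|H\|_\infty$ is the operator norm. $\nu(x)=x(1-x)$. Noise. Each gate is followed by the Pauli channel $\mathcal E(\rho)=(1-\epsilon)\rho+\epsilon\sum_jE_j\rho E_j^\dagger$, $0\le\epsilon\le1$, with $E_j=\sqrt{p_j}\,P_{s_{j,0}}\otimes\cdots\otimes P_{s_{j,n-1}}$ distinct non-identity Pauli strings ($P_0=I,P_1=X,P_2=Y,P_3=Z$), $p_j\ge0$, $\sum_jp_j=1$. The noisy state is $\rho^{\mathcal E}(\theta)=(\mathcal E\circ\mathcal U_D^{\theta_D})\circ\cdots\circ(\mathcal E\circ\mathcal U_1^{\theta_1})(|0\rangle\langle0|)$. For $\gamma>0$ the error density matrix is $\tilde\rho(\theta)=\frac1\gamma\bigl(\rho^{\mathcal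 E}(\theta)-(1-\gamma)\Psi(\theta)\bigr)$, which is a density operator; for $\gamma=0$ it may be taken to be an arbitrary density operator. Outcome probabilities: $p(y|\theta)=\operatorname{Tr}(\Pi_y\Psi(\theta))$, $p^{\mathcal E}(y|\theta)=\operatorname{Tr}(\Pi_y\rho^{\mathcal E}(\theta))$, $\tilde p(y|\theta)=\operatorname{Tr}(\Pi_y\tilde\rho(\theta))$. Gradient estimator. $\widehat{\langle H\rangle}_\rho$ is the average of $N_m$ i.i.d. outcomes of measuring $H$ in state $\rho$ (outcome $h_y$ with probability $\operatorname{Tr}(\Pi_y\rho)$). With $e_d$ the $d$-th standard basis vector, $[\hat g^{\mathcal E}_t]_d=\frac12\bigl(\widehat{\langle H\rangle}_{\rho^{\mathcal E}(\theta^t+\frac\pi2e_d)}-\widehat{\langle H\rangle}_{\rho^{\mathcal E}(\theta^t-\frac\pi2e_d)}\bigr)$ for $d=1,\dots,D$, with mutually independent empirical averages; expectations are over these measurements. *)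

(* Defs.v *)
From HB Require Import structures.
From mathcomp Require Import all_boot all_order all_algebra.
From mathcomp.real_closed Require Import complex mxtens.
From mathcomp Require Import all_classical all_reals all_analysis.

Set Implicit Arguments.
Unset Strict Implicit.
Unset Printing Implicit Defensive.

Import Order.TTheory GRing.Theory Num.Theory.
Import numFieldNormedType.Exports.

Local Open Scope classical_set_scope.
Local Open Scope sesquilinear_scope.
Local Open Scope complex_scope.
Local Open Scope ring_scope.

(* Operators on n qubits are matrices 'M[R[i]]_(2 ^ n); M ^t* is the adjoint.
   Parameter vectors are rows 'rV[R]_D, and the index d = 1, ..., D of the
   mathematics is d : 'I_D, starting at 0. *)

Definition expm (K : numFieldType) m (A : 'M[K]_m) : 'M[K]_m :=
  limn (series (fun k => (k`!%:R)^-1 *: A ^+ k)).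

Section Operators.
Context {R : realType}.
Notation C := R[i].

Definition mx2 (a b c d : C) : 'M[C]_2 :=
  \matrix_(i, j) if i == ord0 then (if j == ord0 then a else b)
                 else (if j == ord0 then c else d).

Definition pauli (k : 'I_4) : 'M[C]_2 :=
  match val k with
  | 0 => 1%:M
  | 1 => mx2 0 1 1 0
  | 2 => mx2 0 (- 'i%C) 'i%C 0
  | _ => mx2 1 0 0 (- 1)
  end.

Fixpoint pauli_string n : {ffun 'I_n -> 'I_4} -> 'M[C]_(2 ^ n) :=
  match n with
  | 0 => fun _ => 1%:M
  | m.+1 => fun s =>
      castmx (esym (expnS 2 m), esym (expnS 2 m))
        (tensmx (pauli (s ord0)) (pauli_string [ffun k => s (lift ord0 k)]))
  end.

Definition density_operator m (rho : 'M[C]_m) :=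
  [/\ rho \is hermsymmx,
      forall v : 'cV[C]_m, 0 <= (v ^t* *m rho *m v) 0 0
    & \tr rho = 1].

Definition cnorm2 m (v : 'cV[C]_m) : R :=
  Num.sqrt (\sum_i (complex.Re (v i 0) ^+ 2 + complex.Im (v i 0) ^+ 2)).

Definition opnorm m (A : 'M[C]_m) : R :=
  sup [set cnorm2 (A *m v) | v in [set v : 'cV[C]_m | cnorm2 v = 1]].

(* Traces of products of two Hermitian operators are real, so nothing is lost
   by taking the real part. *)
Definition expval m (A rho : 'M[C]_m) : R := complex.Re (\tr (A *m rho)).

(* P is the orthogonal projection onto the eigenspace of A for a.  The space
   [eigenspace A a] consists of left (row) eigenvectors; as P and A are
   Hermitian, its equality with the row space of P is, by taking adjoints, the
   equality of the range of P with the space of right eigenvectors. *)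
Definition eigenprojection m (A : 'M[C]_m) (a : C) (P : 'M[C]_m) :=
  [/\ P \is hermsymmx, P *m P = P & (P :=: eigenspace A a)%MS].

Record observable n Nh := Observable {
  obs_mx : 'M[C]_(2 ^ n);
  outcome : 'I_Nh -> R;
  eigproj : 'I_Nh -> 'M[C]_(2 ^ n);
  obs_herm : obs_mx \is hermsymmx;
  outcome_inj : injective outcome;
  outcome_spec : forall a : C,
    eigenvalue obs_mx a <-> exists y, a = (outcome y)%:C;
  eigprojP : forall y, eigenprojection obs_mx (outcome y)%:C (eigproj y);
  obs_mxE : obs_mx = \sum_y (outcome y)%:C *: eigproj y
}.

End Operators.

Section Circuit.
Context {R : realType} {n D : nat}.
Notation C := R[i].
Notation op := 'M[C]_(2 ^ n).

Record circuit := Circuit {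
  generator : 'I_D -> {ffun 'I_n -> 'I_4};
  fixed_gate : 'I_D -> op;
  fixed_gate_unitary : forall d, fixed_gate d \is unitarymx
}.

Record pauli_noise := PauliNoise {
  noise_rate : R;
  nb_errors : nat;
  err_string : 'I_nb_errors -> {ffun 'I_n -> 'I_4};
  err_prob : 'I_nb_errors -> R;
  noise_rate_range : 0 <= noise_rate <= 1;
  err_string_inj : injective err_string;
  err_string_neq1 : forall j, err_string j != [ffun=> ord0];
  err_prob_ge0 : forall j, 0 <= err_prob j;
  err_prob_sum : \sum_j err_prob j = 1
}.

Definition err_op (E : pauli_noise) (j : 'I_(nb_errors E)) : op :=
  (Num.sqrt (err_prob j))%:C *: pauli_string (err_string j).

Definition noise_channel (E : pauli_noise) (rho : op) : op :=
  (1 - noise_rate E)%:C *: rho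
  + (noise_rate E)%:C *: \sum_(j < nb_errors E) (err_op j *m rho *m (err_op j) ^t*).

Definition gate (c : circuit) (theta : 'rV[R]_D) (d : 'I_D) : op :=
  expm (- 'i%C * (theta 0 d / 2)%:C *: pauli_string (generator c d))
  *m fixed_gate c d.

Definition gate_channel c theta d (rho : op) : op :=
  gate c theta d *m rho *m (gate c theta d) ^t*.

Definition ket0 : 'cV[C]_(2 ^ n) := \col_i ((i == 0%N :> nat)%:R).

(* [enum 'I_D] is increasing: gate 0 is applied first, gate D.-1 last. *)
Definition psi c theta : 'cV[C]_(2 ^ n) :=
  foldl (fun v d => gate c theta d *m v) ket0 (enum 'I_D).

Definition pure_state c theta : op := psi c theta *m (psi c theta) ^t*.

Definition noisy_state c E theta : op :=
  foldl (fun rho d => noise_channel E (gate_channel c theta d rho))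
    (ket0 *m ket0 ^t*) (enum 'I_D).

Definition gamma (E : pauli_noise) : R := 1 - (1 - noise_rate E) ^+ D.

Definition error_density_matrix c E (rhot : 'rV[R]_D -> op) :=
  forall theta,
    (0 < gamma E ->
       rhot theta = (gamma E)^-1%:C *:
         (noisy_state c E theta - (1 - gamma E)%:C *: pure_state c theta))
    /\ (gamma E = 0 -> density_operator (rhot theta)).

Definition nu (x : R) : R := x * (1 - x).

Context {Nh : nat}.
Implicit Type H : @observable R n Nh.

Definition loss c H theta : R := expval (obs_mx H) (pure_state c theta).

Definition prob H (rho : 'rV[R]_D -> op) (y : 'I_Nh) (theta : 'rV[R]_D) : R :=
  expval (eigproj H y) (rho theta).

(* The maximum over y and theta, written as a supremum; that the suprema are
   attained is a claim to be proved, not part of this definition. *)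
Definition cgamma c E H : R :=
  sup [set sup [set nu (prob H (noisy_state c E) y theta) |
                theta in [set: 'rV[R]_D]] | y in [set: 'I_Nh]].

Definition gradient (f : 'rV[R]_D -> R) (theta : 'rV[R]_D) : 'rV[R]_D :=
  \row_d 'D_(delta_mx 0 d) f theta.

Definition sqnorm (v : 'rV[R]_D) : R := \sum_d (v 0 d) ^+ 2.

(* Shift of the d-th parameter by + pi / 2 (b = true) or - pi / 2 (b = false). *)
Definition shift_param (theta : 'rV[R]_D) (d : 'I_D) (b : bool) : 'rV[R]_D :=
  theta + ((if b then 1 else -1) * (pi / 2)) *: delta_mx 0 d.

Context {disp : measure_display} {T : measurableType disp}.
Context (P : probability T R).

Definition mutually_independent (I : finType) (X : I -> T -> R) :=
  forall (J : {set I}) (A : I -> set R),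
    (forall i, measurable (A i)) ->
    P (\bigcap_(i in [set` J]) (X i @^-1` A i)) =
    (\prod_(i in J) P (X i @^-1` A i))%E.

Context {Nm : nat}.

Definition emp_mean (X : 'I_Nm -> T -> R) (w : T) : R :=
  (\sum_k X k w) / Nm%:R.

(* [X d b k] is the outcome of the k-th measurement of H in the noisy state at
   the parameter shifted by [shift_param theta d b]. *)
Definition measurement_outcomes c E H theta
    (X : 'I_D -> bool -> 'I_Nm -> {RV P >-> R}) :=
  [/\ forall d b k y, P (X d b k @^-1` [set outcome H y]) =
        (prob H (noisy_state c E) y (shift_param theta d b))%:E,
      forall d b, mutually_independent (fun k => X d b k)
    & mutually_independent
        (fun db : 'I_D * bool => emp_mean (fun k => X db.1 db.2 k))].

Context (X : 'I_D -> bool -> 'I_Nm -> {RV P >-> R}).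

Definition grad_est (w : T) : 'rV[R]_D :=
  \row_d ((emp_mean (fun k => X d true k) w
           - emp_mean (fun k => X d false k) w) / 2).

Definition mean_grad_est : 'rV[R]_D :=
  \row_d fine 'E_P[fun w => grad_est w 0 d].

Definition xi (w : T) : 'rV[R]_D := grad_est w - mean_grad_est.

Definition bias c H theta : 'rV[R]_D :=
  mean_grad_est - gradient (loss c H) theta.

End Circuit.

Arguments circuit : clear implicits.
Arguments pauli_noise : clear implicits.
Arguments observable : clear implicits.
Arguments gamma {R n} D E.

(* Main.v *)
(* Noise: conjugating by gates and applying the Pauli channel keeps the ideal
   state with weight [(1 - epsilon) ^ D = 1 - gamma] and otherwise adds a positive
   operator, so [noisy - (1 - gamma) ideal] is positive of trace gamma.  As H is a
   combination of its eigenprojections, noisy and ideal expectations of H differ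
   by at most [2 ||H|| gamma]; with the parameter-shift rule each entry of the bias
   is at most [2 ||H|| gamma], and [gamma ^ 2 <= gamma].
   Variance: an outcome X satisfies [X - E X = sum_y h_y (1_(X = h_y) - p_y)], so
   by Cauchy-Schwarz [Var X <= N_h sum_y h_y ^ 2 nu(p_y)], while
   [sum_y h_y ^ 2 <= Tr (H ^ 2)] because every eigenprojection has rank at least 1.
   Independence divides this by N_m and makes the two shifted estimators add up.
   The maximum defining c(gamma) is attained because the noisy state is continuous
   and [4 pi]-periodic in each parameter. *)

Require Import Defs.
From mathcomp Require Import all_boot all_order all_algebra.
From mathcomp.real_closed Require Import complex mxtens.
From mathcomp Require Import all_classical all_reals all_analysis.
From mathcomp Require Import measurable_realfun.
From mathcomp Require Import ring lra.

Import Order.TTheory GRing.Theory Num.Theory.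
Import numFieldNormedType.Exports.
Set Implicit Arguments.
Unset Strict Implicit.
Unset Printing Implicit Defensive.
Local Open Scope classical_set_scope.
Local Open Scope sesquilinear_scope.
Local Open Scope complex_scope.
Local Open Scope ring_scope.

(** * Positive semidefinite matrices and operator norm *)

Section ComplexMatrices.
Context {R : realType}.
Notation C := R[i].
Notation Re := complex.Re.
Notation Im := complex.Im.

Lemma conjCE (z : C) : Num.conj z = (Re z) -i* (Im z).
Proof. by case: z. Qed.

Lemma ReD (x y : C) : Re (x + y) = Re x + Re y.
Proof. by case: x y => [a b] [c d]. Qed.

Lemma ReN (x : C) : Re (- x) = - Re x.
Proof. by case: x => [a b]. Qed.

Lemma ReM (x y : C) : Re (x * y) = Re x * Re y - Im x * Im y.
Proof. by case: x y => [a b] [c d]. Qed.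

Lemma ImD (x y : C) : Im (x + y) = Im x + Im y.
Proof. by case: x y => [a b] [c d]. Qed.

Lemma ImM (x y : C) : Im (x * y) = Re x * Im y + Im x * Re y.
Proof. by case: x y => [a b] [c d]. Qed.

Lemma ReZ (a : R) (x : C) : Re (a%:C * x) = a * Re x.
Proof. by rewrite ReM /= mul0r subr0. Qed.

Lemma Re_sum I (r : seq I) (P : pred I) (F : I -> C) :
  Re (\sum_(i <- r | P i) F i) = \sum_(i <- r | P i) Re (F i).
Proof. by elim/big_rec2: _ => // i x y _ <-; rewrite ReD. Qed.

Lemma Im_sum I (r : seq I) (P : pred I) (F : I -> C) :
  Im (\sum_(i <- r | P i) F i) = \sum_(i <- r | P i) Im (F i).
Proof. by elim/big_rec2: _ => // i x y _ <-; rewrite ImD. Qed.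

Lemma adj_mul m n p (A : 'M[C]_(m, n)) (B : 'M[C]_(n, p)) :
  (A *m B) ^t* = B ^t* *m A ^t*.
Proof. by rewrite trmx_mul map_mxM. Qed.

Lemma adjD m n (A B : 'M[C]_(m, n)) : (A + B) ^t* = A ^t* + B ^t*.
Proof. by rewrite linearD map_mxD. Qed.

Lemma adjZ m n (a : C) (A : 'M[C]_(m, n)) : (a *: A) ^t* = Num.conj a *: A ^t*.
Proof. by rewrite linearZ map_mxZ. Qed.

Lemma adj1 m : (1%:M : 'M[C]_m) ^t* = 1%:M.
Proof. by rewrite trmx1 map_mx1. Qed.

Lemma conjC_real (a : R) : Num.conj (a%:C) = a%:C.
Proof. by rewrite conjCE /= oppr0. Qed.

Lemma hermsymmx_adj m (A : 'M[C]_m) : A \is hermsymmx -> A ^t* = A.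
Proof. by move=> /is_hermitianmxP {2}->; rewrite expr0 scale1r. Qed.

(** Positivity is put on the real part of the quadratic form, to match [expval], which is also a
    real part. In this form it passes directly through sums, conjugations and traces. *)
Variant psd m (A : 'M[C]_m) : Prop :=
  Psd of forall v : 'cV[C]_m, 0 <= Re ((v ^t* *m A *m v) 0 0).

Lemma psd_conj m n (M : 'M[C]_(n, m)) (A : 'M[C]_m) :
  psd A -> psd (M *m A *m M ^t*).
Proof.
by move=> [pA]; split=> v; have := pA (M ^t* *m v); rewrite adj_mul trmxCK !mulmxA.
Qed.

Lemma psdD m (A B : 'M[C]_m) : psd A -> psd B -> psd (A + B).
Proof.
by move=> [pA] [pB]; split=> v; rewrite mulmxDr mulmxDl mxE ReD addr_ge0.
Qed.

Lemma psdZ m (a : R) (A : 'M[C]_m) : 0 <= a -> psd A -> psd (a%:C *: A).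
Proof.
by move=> a0 [pA]; split=> v; rewrite -scalemxAr -scalemxAl mxE ReZ mulr_ge0.
Qed.

Lemma psd0 m : psd (0 : 'M[C]_m).
Proof. by split=> v; rewrite mulmx0 mul0mx mxE. Qed.

Lemma psd_sum m I (r : seq I) (F : I -> 'M[C]_m) :
  (forall i, psd (F i)) -> psd (\sum_(i <- r) F i).
Proof.
move=> pF; elim: r => [|i r IH]; first by rewrite big_nil; exact: psd0.
by rewrite big_cons; apply: psdD; [exact: pF|exact: IH].
Qed.

(** The quadratic form at [w] is the squared modulus of the inner product of [v] and [w]. *)
Lemma psd_outer m (v : 'cV[C]_m) : psd (v *m v ^t*).
Proof.
split=> w; rewrite mulmxA -mulmxA.
have -> : w ^t* *m v = (v ^t* *m w) ^t* by rewrite adj_mul trmxCK.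
rewrite mxE big_ord1 !mxE conjCE ReM /=.
by rewrite mulNr opprK -!expr2 addr_ge0 ?sqr_ge0.
Qed.

Lemma psd_trace_ge0 m (A : 'M[C]_m) : psd A -> 0 <= Re (\tr A).
Proof.
move=> [pA]; rewrite Re_sum sumr_ge0 // => i _.
have := pA (delta_mx i 0).
rewrite trmx_delta map_delta_mx -rowE -colE !mxE; exact.
Qed.

Lemma expvalD m (A S S' : 'M[C]_m) : expval A (S + S') = expval A S + expval A S'.
Proof. by rewrite /expval mulmxDr mxtraceD ReD. Qed.

Lemma expvalZ m (A S : 'M[C]_m) (a : R) : expval A (a%:C *: S) = a * expval A S.
Proof. by rewrite /expval -scalemxAr mxtraceZ ReZ. Qed.

Lemma expvalN m (A S : 'M[C]_m) : expval A (- S) = - expval A S.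
Proof. by rewrite /expval mulmxN raddfN /= ReN. Qed.

Lemma expval_suml m I (r : seq I) (a : I -> R) (A : I -> 'M[C]_m) S :
  expval (\sum_(i <- r) (a i)%:C *: A i) S = \sum_(i <- r) a i * expval (A i) S.
Proof.
elim: r => [|i r IH]; first by rewrite !big_nil /expval mul0mx mxtrace0.
by rewrite !big_cons -IH /expval mulmxDl mxtraceD ReD -scalemxAl mxtraceZ ReZ.
Qed.

(** By idempotence and cyclicity, Tr(QS) = Tr(QSQ), and QSQ is a conjugate of the positive S because
    Q is self-adjoint. *)
Lemma expval_projection_ge0 m (Q S : 'M[C]_m) :
  Q \is hermsymmx -> Q *m Q = Q -> psd S -> 0 <= expval Q S.
Proof.
move=> /hermsymmx_adj Qh QQ pS; rewrite /expval -QQ -mulmxA mxtrace_mulC.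
by apply: psd_trace_ge0; rewrite -[X in _ *m X]Qh; exact: psd_conj.
Qed.

Definition vnorm2 m (v : 'cV[C]_m) : R := Re ((v ^t* *m v) 0 0).

Lemma vnorm2E m (v : 'cV[C]_m) :
  vnorm2 v = \sum_i (Re (v i 0) ^+ 2 + Im (v i 0) ^+ 2).
Proof.
rewrite /vnorm2 mxE Re_sum; apply: eq_bigr => i _.
by rewrite !mxE conjCE ReM /= mulNr opprK -!expr2.
Qed.

Lemma vnorm2_ge0 m (v : 'cV[C]_m) : 0 <= vnorm2 v.
Proof. by rewrite vnorm2E sumr_ge0 // => i _; rewrite addr_ge0 ?sqr_ge0. Qed.

Lemma vnorm2_eq0 m (v : 'cV[C]_m) : vnorm2 v = 0 -> v = 0.
Proof.
rewrite vnorm2E => /eqP; rewrite psumr_eq0 => [/allP v0|i _]; last first.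
  by rewrite addr_ge0 ?sqr_ge0.
apply/colP => i; rewrite mxE; apply/eqP; rewrite eq_complex.
have := v0 i (mem_index_enum _); rewrite paddr_eq0 ?sqr_ge0 //.
by rewrite !sqrf_eq0.
Qed.

Lemma cnorm2E m (v : 'cV[C]_m) : cnorm2 v = Num.sqrt (vnorm2 v).
Proof. by rewrite /cnorm2 vnorm2E. Qed.

Lemma vnorm2Z m (a : R) (v : 'cV[C]_m) : vnorm2 (a%:C *: v) = a ^+ 2 * vnorm2 v.
Proof.
by rewrite /vnorm2 adjZ conjC_real -scalemxAr -scalemxAl !mxE !ReZ mulrA expr2.
Qed.

Lemma cnorm2Z m (a : R) (v : 'cV[C]_m) : cnorm2 (a%:C *: v) = `|a| * cnorm2 v.
Proof. by rewrite !cnorm2E vnorm2Z sqrtrM ?sqr_ge0 // sqrtr_sqr. Qed.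

(** The supremum defining [opnorm] bounds the members of its set only once that set is known to be
    bounded; any crude bound suffices. *)
Lemma opnorm_has_ub m (A : 'M[C]_m) :
  has_ubound [set cnorm2 (A *m v) | v in [set v : 'cV[C]_m | cnorm2 v = 1]].
Proof.
(* Entries of a unit vector have real and imaginary parts at most 1 in absolute value, so both parts
   of entry i of [A *m v] are bounded by the inner sum; the factor 2 counts the two parts. *)
exists (Num.sqrt (\sum_i (2 * (\sum_j (`|Re (A i j)| + `|Im (A i j)|)) ^+ 2))).
move=> _ [v /= v1 <-]; rewrite cnorm2E ler_sqrt; last first.
  by apply: sumr_ge0 => i _; rewrite mulr_ge0 ?sqr_ge0.
have v1' : vnorm2 v = 1.
  move: v1; rewrite cnorm2E => /(congr1 (fun x => x ^+ 2)).
  by rewrite sqr_sqrtr ?vnorm2_ge0 // expr1n.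
have vi j : Re (v j 0) ^+ 2 + Im (v j 0) ^+ 2 <= 1.
  rewrite -v1' vnorm2E (bigD1 j) //= lerDl sumr_ge0 // => k _.
  by rewrite addr_ge0 ?sqr_ge0.
have vR j : `|Re (v j 0)| <= 1.
  rewrite -(expr_le1 (n:=2)) // real_normK ?num_real //; apply: le_trans (vi j).
  by rewrite lerDl sqr_ge0.
have vI j : `|Im (v j 0)| <= 1.
  rewrite -(expr_le1 (n:=2)) // real_normK ?num_real //; apply: le_trans (vi j).
  by rewrite lerDr sqr_ge0.
rewrite vnorm2E; apply: ler_sum => i _.
have bnd (z : C) (b : R) : `|Re z| <= b -> `|Im z| <= b ->
    Re z ^+ 2 + Im z ^+ 2 <= 2 * b ^+ 2.
  move=> h1 h2; rewrite -(real_normK (num_real (Re z))) -(real_normK (num_real (Im z))).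
  have h1' : `|Re z| ^+ 2 <= b ^+ 2 by rewrite lerXn2r ?nnegrE // (le_trans _ h1).
  have h2' : `|Im z| ^+ 2 <= b ^+ 2 by rewrite lerXn2r ?nnegrE // (le_trans _ h2).
  lra.
apply: bnd; rewrite mxE ?Re_sum ?Im_sum; apply: le_trans (ler_norm_sum _ _ _) _;
  apply: ler_sum => j _; rewrite ?ReM ?ImM.
  apply: le_trans (ler_normB _ _) _; rewrite !normrM.
  by rewrite lerD // ler_piMr.
apply: le_trans (ler_normD _ _) _; rewrite !normrM.
by rewrite lerD // ler_piMr.
Qed.

Lemma opnorm_ge m (A : 'M[C]_m) (v : 'cV[C]_m) :
  cnorm2 v = 1 -> cnorm2 (A *m v) <= opnorm A.
Proof. by move=> v1; apply: ub_le_sup; [exact: opnorm_has_ub|exists v]. Qed.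

Lemma normr_eigenvalue_le_opnorm m (A : 'M[C]_m) (a : R) (v : 'cV[C]_m) :
  v != 0 -> A *m v = a%:C *: v -> `|a| <= opnorm A.
Proof.
move=> v0 Av; have c0 : 0 < cnorm2 v.
  rewrite cnorm2E sqrtr_gt0 lt_def vnorm2_ge0 andbT.
  by apply: contraNneq v0 => /vnorm2_eq0 ->.
have u1 : cnorm2 ((cnorm2 v)^-1%:C *: v) = 1.
  by rewrite cnorm2Z ger0_norm ?invr_ge0 ?(ltW c0) // mulVf ?gt_eqF.
have := opnorm_ge A u1.
by rewrite -scalemxAr Av scalerA mulrC -scalerA cnorm2Z u1 mulr1.
Qed.

End ComplexMatrices.

(** * Spectral decomposition of an observable *)

Section Observables.
Context {R : realType} {n Nh : nat} (H : observable R n Nh).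
Notation C := R[i].
Notation Re := complex.Re.
Implicit Types (y z : 'I_Nh) (S : 'M[C]_(2 ^ n)).

Lemma eigproj_adj y : (eigproj H y) ^t* = eigproj H y.
Proof. by have [/hermsymmx_adj] := eigprojP H y. Qed.

Lemma eigproj_idem y : eigproj H y *m eigproj H y = eigproj H y.
Proof. by have [_] := eigprojP H y. Qed.

Lemma eigproj_mul y :
  eigproj H y *m obs_mx H = (outcome H y)%:C *: eigproj H y.
Proof. by apply/eigenspaceP; have [_ _ <-] := eigprojP H y. Qed.

Lemma mul_eigproj y :
  obs_mx H *m eigproj H y = (outcome H y)%:C *: eigproj H y.
Proof.
have := congr1 (fun M => M ^t*) (eigproj_mul y).
by rewrite /= adj_mul adjZ conjC_real eigproj_adj (hermsymmx_adj (obs_herm H)).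
Qed.

(** Evaluating P_y H P_z from the left and from the right gives (h_y - h_z) P_y P_z = 0, and the
    outcomes are distinct. *)
Lemma eigproj_ortho y z : y != z -> eigproj H y *m eigproj H z = 0.
Proof.
move=> yz; have : (outcome H y - outcome H z)%:C *: (eigproj H y *m eigproj H z) = 0.
  rewrite rmorphB /= scalerBl scalemxAl -eigproj_mul -mulmxA mul_eigproj.
  by rewrite -scalemxAr subrr.
move/eqP; rewrite scaler_eq0 => /orP[|/eqP//].
rewrite eq_complex /= eqxx andbT subr_eq0 => /eqP/outcome_inj yz'.
by rewrite yz' eqxx in yz.
Qed.

Lemma eigproj_neq0 y : eigproj H y != 0.
Proof.
have [_ _ Qe] := eigprojP H y.
have : eigenvalue (obs_mx H) (outcome H y)%:C by apply/outcome_spec; exists y.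
by rewrite /eigenvalue -!submx0 Qe.
Qed.

(* [1 - sum_y P_y] annihilates H; were it nonzero, 0 would be an eigenvalue,
   hence an outcome, and [1 - sum_y P_y] would factor through the corresponding
   projection, to which it is orthogonal. *)
Lemma sum_eigproj : \sum_y eigproj H y = 1%:M.
Proof.
pose S := 1%:M - \sum_y eigproj H y.
have SP y : S *m eigproj H y = 0.
  rewrite mulmxBl mul1mx mulmx_suml (bigD1 y) //= eigproj_idem big1 ?addr0 ?subrr //.
  by move=> z zy; exact: eigproj_ortho.
have SH : S *m obs_mx H = 0.
  rewrite obs_mxE mulmx_sumr big1 // => y _.
  by rewrite -scalemxAr SP scaler0.
have S_eig : (S <= eigenspace (obs_mx H) 0)%MS.
  by apply/eigenspaceP; rewrite SH scale0r.
suff S0 : S = 0 by apply/esym/eqP; rewrite -subr_eq0 -/S S0.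
apply/eqP/negPn/negP => Sn0.
have /outcome_spec[y y0] : eigenvalue (obs_mx H) 0.
  by apply: contraNneq Sn0 => e0; rewrite e0 submx0 in S_eig.
have [_ _ Qe] := eigprojP H y.
move: S_eig; rewrite y0 -Qe => /submxP[D SD].
by case/negP: Sn0; rewrite -(SP y) {2}SD -mulmxA eigproj_idem -SD.
Qed.

Lemma expval_eigproj_ge0 y S : psd S -> 0 <= expval (eigproj H y) S.
Proof. by have [Ph PP _] := eigprojP H y; exact: expval_projection_ge0. Qed.

Lemma sum_expval_eigproj S : \sum_y expval (eigproj H y) S = Re (\tr S).
Proof.
rewrite -[in RHS](mul1mx S) -sum_eigproj -[RHS]/(expval _ S).
rewrite (eq_bigr (fun y => (1 : R)%:C *: eigproj H y)); last first.
  by move=> y _; rewrite scale1r.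
by rewrite expval_suml; apply: eq_bigr => y _; rewrite mul1r.
Qed.

Lemma expval_obs S :
  expval (obs_mx H) S = \sum_y outcome H y * expval (eigproj H y) S.
Proof. by rewrite obs_mxE expval_suml. Qed.

(** In a full-rank factorisation AB of an idempotent, the outer factors of ABAB = AB cancel on both
    sides. *)
Lemma idem_factor (F : fieldType) m r (A : 'M[F]_(m, r)) (B : 'M[F]_(r, m)) A' B' :
  A' *m A = 1%:M -> B *m B' = 1%:M -> A *m B *m (A *m B) = A *m B ->
  B *m A = 1%:M.
Proof.
move=> AA BB /(congr1 (fun M => A' *m M *m B')) /=.
by rewrite !mulmxA AA !mul1mx -!mulmxA BB !mulmx1.
Qed.

(** Write Q = AB with A of full column rank and B of full row rank; then Tr(AB) = Tr(BA), and BA is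
    the identity of size the rank of Q. *)
Lemma idem_mxtrace_rank (F : fieldType) m (Q : 'M[F]_m) :
  Q *m Q = Q -> \tr Q = (\rank Q)%:R.
Proof.
move=> QQ; rewrite -{1}(mulmx_base Q) mxtrace_mulC.
have /row_fullP[B BC] := col_base_full Q.
have /row_freeP[B' RB] := row_base_free Q.
by rewrite (idem_factor BC RB) ?mxtrace1 // mulmx_base.
Qed.

Lemma eigproj_trace_ge1 y : 1 <= Re (\tr (eigproj H y)).
Proof.
rewrite (idem_mxtrace_rank (eigproj_idem y)).
have -> : ((\rank (eigproj H y))%:R : C) = (((\rank (eigproj H y))%:R : R)%:C).
  by rewrite rmorph_nat.
by rewrite /= ler1n lt0n mxrank_eq0 eigproj_neq0.
Qed.

(** Tr(H^2) is the sum of h_y^2 Tr(P_y), and each of these traces is a rank, at least 1. *)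
Lemma sum_sqr_outcome_le :
  \sum_y outcome H y ^+ 2 <= Re (\tr (obs_mx H *m obs_mx H)).
Proof.
rewrite -[leRHS]/(expval _ _) expval_obs; apply: ler_sum => y _.
rewrite /expval eigproj_mul mxtraceZ ReZ mulrA -expr2.
by rewrite ler_peMr ?sqr_ge0 ?eigproj_trace_ge1.
Qed.

Lemma outcome_le_opnorm y : `|outcome H y| <= opnorm (obs_mx H).
Proof.
(* A nonzero column of the eigenprojection is an eigenvector for its outcome. *)
have [j Qj] : exists j, col j (eigproj H y) != 0.
  apply/existsP; apply: contraNT (eigproj_neq0 y) => /existsPn Q0.
  apply/eqP/matrixP => i j; have /negbNE/eqP/colP/(_ i) := Q0 j.
  by rewrite !mxE.
apply: (normr_eigenvalue_le_opnorm Qj).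
by rewrite colE mulmxA mul_eigproj scalemxAl.
Qed.

(** The expectation is a combination of outcomes with nonnegative weights Tr(P_y S) that add up to
    Tr(S). No normalisation is imposed on S, so this covers both the ideal state and the remainder
    of trace gamma. *)
Lemma normr_expval_obs_le S : psd S ->
  `|expval (obs_mx H) S| <= opnorm (obs_mx H) * Re (\tr S).
Proof.
move=> pS; rewrite expval_obs -sum_expval_eigproj mulr_sumr.
apply: le_trans (ler_norm_sum _ _ _) _; apply: ler_sum => y _.
have q0 := expval_eigproj_ge0 y pS.
by rewrite normrM (ger0_norm q0) ler_wpM2r ?outcome_le_opnorm.
Qed.

End Observables.

(** * Pauli rotations *)

Section PauliRotations.
Context {R : realType}.
Notation C := R[i].
Notation Re := complex.Re.
Notation Im := complex.Im.

Lemma pauli_adj (k : 'I_4) : (pauli k : 'M[C]_2) ^t* = pauli k.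
Proof.
case: k => [[|[|[|[|k]]]] lk] //; rewrite /pauli /=; first exact: adj1.
all: apply/matrixP => i j; rewrite !mxE conjCE.
all: case: i j => [[|[|i]] li] [[|[|j]] lj] //; rewrite -!val_eqE /=.
all: by apply/eqP; rewrite eq_complex /= ?(oppr0, opprK) ?eqxx.
Qed.

Lemma pauli_sqr (k : 'I_4) : (pauli k : 'M[C]_2) *m pauli k = 1%:M.
Proof.
case: k => [[|[|[|[|k]]]] lk] //; rewrite /pauli /=; first exact: mulmx1.
all: apply/matrixP => i j; rewrite mxE !big_ord_recl big_ord0 addr0 !mxE.
all: case: i j => [[|[|i]] li] [[|[|j]] lj] //=.
all: rewrite -?val_eqE /= ?(mulr0, mul0r, addr0, add0r, mulr1, mulrNN) //.
all: by rewrite ?mulNr ?mulrN -?expr2 ?sqr_i ?opprK.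
Qed.

Lemma castmx_mulmx (F : pzRingType) m m' (e : m = m') (A B : 'M[F]_m) :
  castmx (e, e) A *m castmx (e, e) B = castmx (e, e) (A *m B).
Proof. by case: m' / e. Qed.

Lemma castmx_scalar_mx (F : pzRingType) m m' (e : m = m') (a : F) :
  castmx (e, e) (a%:M) = a%:M.
Proof. by case: m' / e. Qed.

Lemma castmx_adj m m' (e : m = m') (A : 'M[C]_m) :
  (castmx (e, e) A) ^t* = castmx (e, e) (A ^t*).
Proof. by case: m' / e. Qed.

Lemma tensmx11 (F : comPzRingType) m p :
  tensmx (1%:M : 'M[F]_m) (1%:M : 'M[F]_p) = 1%:M.
Proof.
apply/matrixP => i j; case: (mxtens_indexP i) => i0 i1; case: (mxtens_indexP j) => j0 j1.
rewrite tensmxE !mxE (can_eq (@mxtens_indexK _ _)) xpair_eqE.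
by case: eqP; case: eqP; rewrite ?mulr0 ?mul0r ?mulr1.
Qed.

Lemma pauli_string_adj n (s : {ffun 'I_n -> 'I_4}) :
  (pauli_string s : 'M[C]_(2 ^ n)) ^t* = pauli_string s.
Proof.
elim: n s => [|n IH] s /=; first exact: adj1.
by rewrite castmx_adj trmx_tens map_mxT pauli_adj IH.
Qed.

Lemma pauli_string_sqr n (s : {ffun 'I_n -> 'I_4}) :
  pauli_string s *m pauli_string s = 1%:M :> 'M[C]_(2 ^ n).
Proof.
elim: n s => [|n IH] s /=; first exact: mulmx1.
by rewrite castmx_mulmx tensmx_mul pauli_sqr IH tensmx11 castmx_scalar_mx.
Qed.

(** Euler's formula for exp(-itP) with P an involution; [t] is half the gate parameter. *)
Definition pauli_rot n (s : {ffun 'I_n -> 'I_4}) (t : R) : 'M[C]_(2 ^ n) :=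
  (cos t)%:C *: 1%:M - ('i%C * (sin t)%:C) *: pauli_string s.

Lemma pauli_string_exp n (s : {ffun 'I_n -> 'I_4}) k :
  pauli_string s ^+ k = if odd k then pauli_string s else 1%:M :> 'M[C]_(2 ^ n).
Proof.
elim: k => // k IH; rewrite exprS IH /=; case: (odd k) => /=.
  exact: pauli_string_sqr.
exact: mulmx1.
Qed.

Lemma cvg_real_complex (u : nat -> R) (l : R) :
  u @ \oo --> l ->
  ((u k)%:C : (C : numFieldType)) @[k --> \oo] --> (l%:C : (C : numFieldType)).
Proof.
move=> ul; apply/cvgrPdist_lt => e e0.
(* In the partial order on the complex numbers, a positive tolerance is real. *)
have [er ee] : (0 < Re e) /\ e = (Re e)%:C.
  by move: e0; rewrite ltcE /= => /andP[/eqP ei ->]; split=> //; case: e ei => a b /= ->.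
move/cvgrPdist_lt : ul => /(_ _ er); apply: filterS => k.
by rewrite -rmorphB ee normc_def /= expr0n addr0 sqrtr_sqr ltcR.
Qed.

(** Powers of a Pauli string alternate between 1 and the string itself, so even terms of the
    exponential series feed the cosine and odd terms the sine. *)
Lemma exp_coeff_pauli n (s : {ffun 'I_n -> 'I_4}) (t : R) k :
  (k`!%:R)^-1 *: (- 'i%C * t%:C *: pauli_string s) ^+ k =
  (cos_coeff t k)%:C *: 1%:M - ('i%C * (sin_coeff t k)%:C) *: pauli_string s
    :> 'M[C]_(2 ^ n).
Proof.
have -> : (- 'i%C * t%:C *: pauli_string s) ^+ k =
    (- 'i%C * t%:C) ^+ k *: (pauli_string s : 'M[C]_(2 ^ n)) ^+ k.
  elim: k => [|k IH]; first by rewrite !expr0 scale1r.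
  by rewrite !exprS IH -[LHS]/(_ *m _) -scalemxAl -scalemxAr scalerA.
have iE : (k`!%:R : C)^-1 = ((k`!%:R)^-1 : R)%:C by rewrite fmorphV rmorph_nat.
have even_pow j : (- 'i%C * t%:C) ^+ j.*2 = ((-1) ^+ j * t ^+ j.*2)%:C :> C.
  have sq : (- 'i%C * t%:C) ^+ 2 = (-1 * t ^+ 2)%:C :> C.
    by rewrite exprMn sqrrN sqr_i rmorphM /= rmorphN1 rmorphXn.
  by rewrite -mul2n !exprM sq -rmorphXn exprMn.
rewrite pauli_string_exp scalerA iE /cos_coeff /sin_coeff /= -exprnP.
case: ifP => ko /=.
(* The sign in [sin_coeff] has exponent [(k.-1)./2], so the odd index is written with this half. *)
- have kE : k = (k.-1)./2.*2.+1.
    by case: k ko {iE} => //= k /even_halfK ->.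
  rewrite !mul0r scale0r add0r mul1r -scaleNr; congr (_ *: _).
  rewrite {2 4}kE exprS even_pow !rmorphM /= exprS rmorphM /=; ring.
- have kE : k = k./2.*2 by rewrite -[LHS]odd_double_half ko.
  rewrite !mul0r mulr0 scale0r subr0 mul1r; congr (_ *: _).
  by rewrite {2 4}kE even_pow mulrC -rmorphM.
Qed.

Lemma expm_pauli n (s : {ffun 'I_n -> 'I_4}) (t : R) :
  expm (- 'i%C * t%:C *: pauli_string s) = pauli_rot s t.
Proof.
apply: cvg_lim; first exact: norm_hausdorff.
have -> : series (fun k : nat =>
    k`!%:R^-1 *: ((- 'i%C * t%:C) *: (pauli_string s : 'M[C]_(2 ^ n))) ^+ k) =
  (fun N => ((series (cos_coeff t) N)%:C : (C : numFieldType)) *: 1%:M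
     - (('i%C : (C : numFieldType)) * (series (sin_coeff t) N)%:C) *: pauli_string s).
  apply/funext => N; rewrite /series /=.
  rewrite !rmorph_sum /= mulr_sumr !scaler_suml -sumrB.
  by apply: eq_bigr => k _; exact: exp_coeff_pauli.
apply: cvgB; apply: cvgZ; [|exact: cvg_cst| |exact: cvg_cst].
  by apply: cvg_real_complex; rewrite unlock; exact: is_cvg_series_cos_coeff.
apply: cvgM; first exact: cvg_cst.
by apply: cvg_real_complex; rewrite unlock; exact: is_cvg_series_sin_coeff.
Qed.

Lemma pauli_rot_unitary n (s : {ffun 'I_n -> 'I_4}) (t : R) :
  pauli_rot s t \is unitarymx.
Proof.
apply/unitarymxP; rewrite /pauli_rot -scaleNr adjD !adjZ adj1 pauli_string_adj.
have -> : Num.conj (- ('i%C * (sin t)%:C)) = 'i%C * (sin t)%:C :> C.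
  rewrite conjCE; apply/eqP; rewrite eq_complex /=.
  by rewrite !(mul0r, mulr0, mul1r, subr0, addr0, add0r, oppr0, opprK) !eqxx.
set a := 'i%C * _; set c := (cos t)%:C.
rewrite conjC_real -/c mulmxDl !mulmxDr -!scalemxAl -!scalemxAr !mulmx1 !mul1mx.
rewrite pauli_string_sqr !scalerA mulNr [a * c]mulrC scaleNr addrA addrK -scalerDl.
have ii : 'i%C * 'i%C = -1 :> C by rewrite -expr2 sqr_i.
rewrite /a /c mulNr mulrACA ii mulN1r opprK -!rmorphM -rmorphD /=.
by rewrite -!expr2 cos2Dsin2 scale1r.
Qed.

(** Multiplying by -iP advances the angle by pi/2, so a rotated gate is a real combination of two
    fixed ones. This linearity is the source of the parameter-shift rule. *)
Lemma pauli_rotD n (s : {ffun 'I_n -> 'I_4}) (a b : R) :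
  pauli_rot s (a + b) = (cos b)%:C *: pauli_rot s a
    + (sin b)%:C *: pauli_rot s (a + pi / 2).
Proof.
rewrite /pauli_rot cosD sinD cosDpihalf sinDpihalf !scalerBr !scalerA.
rewrite addrACA -!opprD -!scalerDl.
congr (_ *: _ - _ *: _); rewrite ?(rmorphD, rmorphB, rmorphM, rmorphN) /=; ring.
Qed.

Lemma pauli_rotD2pi n (s : {ffun 'I_n -> 'I_4}) (a : R) :
  pauli_rot s (a + pi *+ 2) = pauli_rot s a.
Proof. by rewrite /pauli_rot sinD2pi cosD2pi. Qed.

End PauliRotations.

(** * Noisy evolution *)

Section NoisyEvolution.
Context {R : realType} {n D : nat} (c : circuit R n D) (E : pauli_noise R n).
Notation C := R[i].
Notation Re := complex.Re.
Implicit Types (theta : 'rV[R]_D) (rho : 'M[C]_(2 ^ n)) (v : 'cV[C]_(2 ^ n)).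

Lemma gateE theta d :
  gate c theta d = pauli_rot (generator c d) (theta 0 d / 2) *m fixed_gate c d.
Proof. by rewrite /gate expm_pauli. Qed.

#[local] Opaque gate.

Lemma gate_unitary theta d : gate c theta d \is unitarymx.
Proof.
by rewrite gateE mul_unitarymx ?pauli_rot_unitary ?fixed_gate_unitary.
Qed.

Lemma gate_adjK theta d : (gate c theta d) ^t* *m gate c theta d = 1%:M.
Proof. by apply: mulmx1C; exact/unitarymxP/gate_unitary. Qed.

Lemma err_op_sandwich j rho :
  err_op j *m rho *m (err_op j) ^t* =
  (err_prob (p := E) j)%:C *:
    (pauli_string (err_string j) *m rho *m pauli_string (err_string j)).
Proof.
rewrite /err_op adjZ conjC_real pauli_string_adj -!scalemxAl -scalemxAr scalerA.
by rewrite -rmorphM -expr2 sqr_sqrtr ?err_prob_ge0.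
Qed.

Lemma noise_channel_psd rho : psd rho -> psd (noise_channel E rho).
Proof.
have /andP[e0 e1] := noise_rate_range E.
move=> prho; apply: psdD; apply: psdZ; rewrite ?subr_ge0 //.
by apply: psd_sum => j; exact: psd_conj.
Qed.

Lemma noise_channel_trace rho : \tr (noise_channel E rho) = \tr rho.
Proof.
rewrite /noise_channel mxtraceD !mxtraceZ raddf_sum /=.
have -> : \sum_(j < nb_errors E) \tr (err_op j *m rho *m (err_op j) ^t*) = \tr rho.
  under eq_bigr => j _ do
    rewrite err_op_sandwich mxtraceZ mxtrace_mulC mulmxA pauli_string_sqr mul1mx.
  by rewrite -mulr_suml -rmorph_sum err_prob_sum mul1r.
by rewrite -mulrDl -rmorphD subrK mul1r.
Qed.

(* Gates act on both states by the same conjugation, and the noise keeps each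
   state with weight [1 - noise_rate E], adding a positive operator. *)
Lemma noise_channel_psdB theta d rho v (a : R) : psd rho ->
  psd (rho - a%:C *: (v *m v ^t*)) ->
  psd (noise_channel E (gate_channel c theta d rho)
       - (a * (1 - noise_rate E))%:C *:
         ((gate c theta d *m v) *m (gate c theta d *m v) ^t*)).
Proof.
have /andP[e0 e1] := noise_rate_range E.
move=> prho prho'; set W := gate c theta d.
rewrite /noise_channel /gate_channel -/W.
have -> : (a * (1 - noise_rate E))%:C *: (W *m v *m (W *m v) ^t*) =
   (1 - noise_rate E)%:C *: (W *m (a%:C *: (v *m v ^t*)) *m W ^t*).
  by rewrite adj_mul -scalemxAr -scalemxAl scalerA -rmorphM mulrC !mulmxA.
rewrite addrAC -scalerBr -mulmxBl -mulmxBr; apply: psdD; apply: psdZ; rewrite ?subr_ge0 //.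
  exact: psd_conj.
by apply: psd_sum => j; do 2!apply: psd_conj.
Qed.

(** The start state, vector and weight are kept general as the invariant of the induction on the
    gates: each gate multiplies the weight of the ideal state by [1 - noise_rate E]. *)
Lemma noisy_fold_psd theta (ds : seq 'I_D) rho v (a : R) : psd rho ->
  psd (rho - a%:C *: (v *m v ^t*)) ->
  let rho' := foldl (fun r d => noise_channel E (gate_channel c theta d r)) rho ds in
  let v' := foldl (fun w d => gate c theta d *m w) v ds in
  [/\ psd rho', psd (rho' - (a * (1 - noise_rate E) ^+ size ds)%:C *: (v' *m v' ^t*))
    & \tr rho' = \tr rho].
Proof.
elim: ds rho v a => [|d ds IH] rho v a prho prho' /=; first by rewrite mulr1.
have [] := IH _ _ _ _ (noise_channel_psdB theta d prho prho').
  by apply: noise_channel_psd; exact: psd_conj.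
rewrite exprS mulrA => ? ? ->; split=> //.
rewrite noise_channel_trace /gate_channel mxtrace_mulC mulmxA gate_adjK.
by rewrite mul1mx.
Qed.

Lemma ket0_mul_adj : (ket0 : 'cV[C]_(2 ^ n)) ^t* *m ket0 = 1%:M.
Proof.
rewrite [LHS]mx11_scalar; congr (_%:M); rewrite mxE.
have n0 : (0 < 2 ^ n)%N by rewrite expn_gt0.
rewrite (bigD1 (Ordinal n0)) //= big1 => [|i].
  by rewrite !mxE /= addr0 mulr1 rmorph1.
by rewrite -val_eqE /= => /negbTE i0; rewrite !mxE i0 mulr0.
Qed.

Lemma psi_normalized theta : (psi c theta) ^t* *m psi c theta = 1%:M.
Proof.
rewrite /psi; move: ket0_mul_adj; move: ket0.
elim: (enum _) => //= d ds IH v v1; apply: IH.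
by rewrite adj_mul mulmxA -(mulmxA _ _ (gate _ _ _)) gate_adjK mulmx1.
Qed.

Lemma mxtrace_ket0 : \tr (ket0 *m ket0 ^t* : 'M[C]_(2 ^ n)) = 1.
Proof. by rewrite mxtrace_mulC ket0_mul_adj mxtrace1. Qed.

Lemma pure_state_trace theta : \tr (pure_state c theta) = 1.
Proof. by rewrite /pure_state mxtrace_mulC psi_normalized mxtrace1. Qed.

Lemma pure_state_psd theta : psd (pure_state c theta).
Proof. exact: psd_outer. Qed.

Lemma noisy_state_spec theta :
  [/\ psd (noisy_state c E theta),
      psd (noisy_state c E theta - (1 - gamma D E)%:C *: pure_state c theta)
    & \tr (noisy_state c E theta) = 1].
Proof.
(* With initial weight 1 the remainder is 0; after D gates the weight is [1 - gamma D E]. *)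
have := @noisy_fold_psd theta (enum 'I_D) _ ket0 1 (psd_outer ket0).
rewrite scale1r subrr mul1r size_enum_ord mxtrace_ket0 => /(_ (@psd0 _ _)).
by rewrite /gamma subKr.
Qed.

Lemma gamma_range : 0 <= gamma D E <= 1.
Proof.
have /andP[e0 e1] := noise_rate_range E.
by rewrite /gamma subr_ge0 gerBl exprn_ge0 ?subr_ge0 // exprn_ile1 ?subr_ge0 // gerBl.
Qed.

(** For positive D, (1 - epsilon)^D = 1 forces epsilon = 0, and every noise channel is the
    identity. *)
Lemma noisy_state_gamma0 theta : (0 < D)%N -> gamma D E = 0 ->
  noisy_state c E theta = pure_state c theta.
Proof.
have /andP[e0 e1] := noise_rate_range E.
move=> D0 /eqP; rewrite subr_eq0 eq_sym pexpr_eq1 ?subr_ge0 //.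
rewrite -subr_eq0 addrAC subrr add0r oppr_eq0 => /eqP noise0.
rewrite /noisy_state /pure_state /psi; move: ket0.
elim: (enum _) => //= d ds IH v; rewrite -IH; congr foldl.
rewrite /noise_channel noise0 subr0 scale1r scale0r addr0 /gate_channel.
by rewrite (adj_mul (gate c theta d) v) !mulmxA.
Qed.

Lemma expval_noisy_error Nh (H : observable R n Nh) theta :
  `|expval (obs_mx H) (noisy_state c E theta) - expval (obs_mx H) (pure_state c theta)|
  <= 2 * opnorm (obs_mx H) * gamma D E.
Proof.
have [_ pdiff trn] := noisy_state_spec theta; have /andP[g0 _] := gamma_range.
set rho := noisy_state c E theta in pdiff trn *.
set Psi := pure_state c theta in pdiff *; set A := obs_mx H.
(* The error is the expectation in a positive remainder of trace gamma, minus gamma times the ideal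
   expectation; each part is at most gamma times the operator norm. *)
have -> : expval A rho - expval A Psi =
   expval A (rho - (1 - gamma D E)%:C *: Psi) - gamma D E * expval A Psi.
  by rewrite expvalD expvalN expvalZ; ring.
apply: le_trans (ler_normB _ _) _; rewrite normrM (ger0_norm g0).
have b1 := normr_expval_obs_le H pdiff.
have b2 := normr_expval_obs_le H (pure_state_psd theta).
rewrite pure_state_trace /= mulr1 -/A -/Psi in b2.
have trd : Re (\tr (rho - (1 - gamma D E)%:C *: Psi)) = gamma D E.
  by rewrite -scaleNr mxtraceD mxtraceZ trn pure_state_trace mulr1 ReD ReN /= subKr.
rewrite trd -/A in b1.
have := ler_wpM2l g0 b2; lra.
Qed.

Lemma prob_range Nh (H : observable R n Nh) y theta :
  0 <= prob H (noisy_state c E) y theta <= 1.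
Proof.
have [prho _ trho] := noisy_state_spec theta.
rewrite expval_eigproj_ge0 //=.
have <- : \sum_y prob H (noisy_state c E) y theta = 1.
  by rewrite /prob sum_expval_eigproj trho.
rewrite (bigD1 y) //= lerDl sumr_ge0 // => z _.
exact: expval_eigproj_ge0.
Qed.

Lemma sum_prob Nh (H : observable R n Nh) theta :
  \sum_y prob H (noisy_state c E) y theta = 1.
Proof.
by have [_ _ trho] := noisy_state_spec theta; rewrite /prob sum_expval_eigproj trho.
Qed.

(** For gamma > 0 the noisy probability is a mixture of the ideal and the error probability, and the
    identity is the law of total variance for a Bernoulli variable. For gamma = 0 the terms with
    [rhot] have coefficient 0 and the noisy state is the ideal one. *)
Lemma nu_prob_noisy Nh (H : observable R n Nh) rhot y theta : (0 < D)%N ->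
  error_density_matrix c E rhot ->
  nu (prob H (noisy_state c E) y theta) =
    gamma D E * nu (prob H rhot y theta)
    + nu (1 - gamma D E)
      * (prob H (pure_state c) y theta - prob H rhot y theta) ^+ 2
    + (1 - gamma D E) * nu (prob H (pure_state c) y theta).
Proof.
move=> D0 /(_ theta)[rhotE _]; have /andP[g0 _] := gamma_range.
have [g1|g1] := eqVneq (gamma D E) 0.
  by rewrite /prob noisy_state_gamma0 // g1 /nu; ring.
have {}rhotE := rhotE _.
rewrite /prob rhotE ?lt_def ?g1 // expvalZ expvalD expvalN expvalZ /nu.
by field.
Qed.

End NoisyEvolution.

(** * Continuity and periodicity *)

Section ContinuityPeriodicity.
Context {R : realType} {n D : nat}.
Notation C := R[i].
Notation Re := complex.Re.
Notation Im := complex.Im.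

(** Testing continuity on the two real components reduces everything to real-valued functions. *)
Definition ccontinuous (T : topologicalType) (f : T -> C) :=
  continuous (fun x => Re (f x)) /\ continuous (fun x => Im (f x)).

Definition mxcontinuous (T : topologicalType) m p (f : T -> 'M[C]_(m, p)) :=
  forall i j, ccontinuous (fun x => f x i j).

Lemma ccontinuous_cst (T : topologicalType) (a : C) : ccontinuous (fun _ : T => a).
Proof. by split=> x; exact: cvg_cst. Qed.

Lemma ccontinuousD (T : topologicalType) (f g : T -> C) :
  ccontinuous f -> ccontinuous g -> ccontinuous (fun x => f x + g x).
Proof.
move=> [fr fi] [gr gi]; split=> x.
  under [X in continuous_at _ X]funext do rewrite ReD.
  by apply: cvgD; [exact: fr|exact: gr].
under [X in continuous_at _ X]funext do rewrite ImD.
by apply: cvgD; [exact: fi|exact: gi].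
Qed.

Lemma ccontinuousM (T : topologicalType) (f g : T -> C) :
  ccontinuous f -> ccontinuous g -> ccontinuous (fun x => f x * g x).
Proof.
move=> [fr fi] [gr gi]; split=> x.
  under [X in continuous_at _ X]funext do rewrite ReM.
  by apply: cvgB; apply: cvgM; [exact: fr|exact: gr|exact: fi|exact: gi].
under [X in continuous_at _ X]funext do rewrite ImM.
by apply: cvgD; apply: cvgM; [exact: fr|exact: gi|exact: fi|exact: gr].
Qed.

Lemma ccontinuous_conj (T : topologicalType) (f : T -> C) :
  ccontinuous f -> ccontinuous (fun x => Num.conj (f x)).
Proof.
move=> [fr fi]; split=> x; under [X in continuous_at _ X]funext do rewrite conjCE /=.
  exact: fr.
by apply: cvgN; exact: fi.
Qed.

Lemma ccontinuous_sum (T : topologicalType) I (r : seq I) (f : I -> T -> C) :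
  (forall i, ccontinuous (f i)) -> ccontinuous (fun x => \sum_(i <- r) f i x).
Proof.
move=> fc; elim: r => [|i r IH].
  under [X in ccontinuous X]funext do rewrite big_nil; exact: ccontinuous_cst.
under [X in ccontinuous X]funext do rewrite big_cons; exact: ccontinuousD.
Qed.

Lemma mxcontinuous_cst (T : topologicalType) m p (A : 'M[C]_(m, p)) :
  mxcontinuous (fun _ : T => A).
Proof. by move=> i j; exact: ccontinuous_cst. Qed.

Lemma mxcontinuousD (T : topologicalType) m p (f g : T -> 'M[C]_(m, p)) :
  mxcontinuous f -> mxcontinuous g -> mxcontinuous (fun x => f x + g x).
Proof.
move=> fc gc i j; under [X in ccontinuous X]funext do rewrite mxE.
exact: ccontinuousD.
Qed.

Lemma mxcontinuousZ (T : topologicalType) m p (a : T -> C) (f : T -> 'M[C]_(m, p)) :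
  ccontinuous a -> mxcontinuous f -> mxcontinuous (fun x => a x *: f x).
Proof.
move=> ac fc i j; under [X in ccontinuous X]funext do rewrite mxE.
exact: ccontinuousM.
Qed.

Lemma mxcontinuousM (T : topologicalType) m p q (f : T -> 'M[C]_(m, p))
    (g : T -> 'M[C]_(p, q)) :
  mxcontinuous f -> mxcontinuous g -> mxcontinuous (fun x => f x *m g x).
Proof.
move=> fc gc i j; under [X in ccontinuous X]funext do rewrite mxE.
by apply: ccontinuous_sum => k; exact: ccontinuousM.
Qed.

Lemma mxcontinuous_adj (T : topologicalType) m p (f : T -> 'M[C]_(m, p)) :
  mxcontinuous f -> mxcontinuous (fun x => (f x) ^t*).
Proof.
move=> fc i j; under [X in ccontinuous X]funext do rewrite !mxE.
exact: ccontinuous_conj.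
Qed.

Lemma mxcontinuous_sum (T : topologicalType) m p I (r : seq I)
    (f : I -> T -> 'M[C]_(m, p)) :
  (forall i, mxcontinuous (f i)) -> mxcontinuous (fun x => \sum_(i <- r) f i x).
Proof.
move=> fc i j; under [X in ccontinuous X]funext do rewrite summxE.
by apply: ccontinuous_sum => k; exact: fc.
Qed.

Lemma expval_continuous (T : topologicalType) m (A : 'M[C]_m) (f : T -> 'M[C]_m) :
  mxcontinuous f -> continuous (fun x => expval A (f x)).
Proof.
move=> fc; suff [] : ccontinuous (fun x => \tr (A *m f x)) by [].
apply: ccontinuous_sum => i.
exact: (mxcontinuousM (mxcontinuous_cst _ A) fc).
Qed.

Context (c : circuit R n D) (E : pauli_noise R n).
#[local] Opaque gate.

Lemma gate_continuous d : mxcontinuous (fun theta => gate c theta d).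
Proof.
have th : continuous (fun theta : 'rV[R]_D => theta 0 d / 2).
  move=> theta; apply: (@continuous_comp _ _ _
    (fun theta : 'rV[R]_D => theta 0 d) (fun x => x / 2)).
    exact: coord_continuous.
  exact: mulrr_continuous.
have sn : continuous (fun theta : 'rV[R]_D => sin (theta 0 d / 2)).
  by move=> theta; apply: (continuous_comp (th theta)); exact: continuous_sin.
under [X in mxcontinuous X]funext do rewrite gateE.
apply: mxcontinuousM (mxcontinuous_cst _ _).
rewrite /pauli_rot; under [X in mxcontinuous X]funext do rewrite -scaleNr.
apply: mxcontinuousD; apply: mxcontinuousZ; try exact: mxcontinuous_cst.
  split; last by move=> theta; exact: cst_continuous.
  by move=> theta; apply: (continuous_comp (th theta)); exact: continuous_cos.
split=> theta.
  under [X in continuous_at _ X]funext do rewrite ReN ReM /= mul0r mulr0 subr0 oppr0.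
  exact: cst_continuous.
under [X in continuous_at _ X]funext do rewrite /= mul0r mul1r add0r.
by apply: (continuous_comp (sn theta)); exact: opp_continuous.
Qed.

Lemma noisy_state_continuous : mxcontinuous (noisy_state c E).
Proof.
(* The start state may depend on the parameters, since after one gate it does. *)
have fold_cont (ds : seq 'I_D) (rho : 'rV[R]_D -> 'M[C]_(2 ^ n)) :
    mxcontinuous rho -> mxcontinuous (fun theta =>
      foldl (fun r d => noise_channel E (gate_channel c theta d r)) (rho theta) ds).
  elim: ds rho => //= d ds IH rho rhoc; apply: IH.
  have gc : mxcontinuous (fun theta => gate_channel c theta d (rho theta)).
    apply: mxcontinuousM; last exact/mxcontinuous_adj/gate_continuous.
    by apply: mxcontinuousM => //; exact: gate_continuous.
  apply: mxcontinuousD; apply: mxcontinuousZ; try exact: ccontinuous_cst; first by [].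
  apply: mxcontinuous_sum => j; apply: mxcontinuousM; last exact: mxcontinuous_cst.
  by apply: mxcontinuousM => //; exact: mxcontinuous_cst.
exact: (fold_cont _ (fun=> _) (mxcontinuous_cst _ _)).
Qed.

Lemma periodicz (f : R -> 'M[C]_(2 ^ n)) (p : R) :
  periodic f p -> forall (k : int) a, f (a + p *~ k) = f a.
Proof.
move=> fp [k|k] a; first exact: periodicn.
by rewrite -[LHS](periodicn fp k.+1) NegzE mulrNz -pmulrn subrK.
Qed.

(** Representative modulo 4 pi: gates depend on the half angle, in which rotations have period 2
    pi. *)
Definition reduced_angle (x : R) : R :=
  x - (pi *+ 4) *~ Num.floor (x / (pi *+ 4)).

Lemma reduced_angle_range x : 0 <= reduced_angle x <= pi *+ 4.
Proof.
have p0 : 0 < (pi *+ 4 : R) by rewrite mulrn_wgt0 // pi_gt0.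
have /andP[k1 k2] := floor_itv (x / (pi *+ 4)).
rewrite /reduced_angle -mulrzl; set k := Num.floor _ in k1 k2 *.
rewrite ler_pdivlMr // in k1; rewrite ltr_pdivrMr // intrD mulrDl mul1r in k2.
by rewrite subr_ge0 k1 lerBlDl ltW.
Qed.

Lemma pauli_rot_reduced (s : {ffun 'I_n -> 'I_4}) x :
  pauli_rot s (reduced_angle x / 2) = pauli_rot s (x / 2) :> 'M[C]_(2 ^ n).
Proof.
rewrite -[RHS](periodicz (@pauli_rotD2pi R n s) (- Num.floor (x / (pi *+ 4)))).
congr pauli_rot; rewrite /reduced_angle mulrNz mulrBl; congr (_ - _).
have half (p : R) (k : int) : p *+ 4 *~ k / 2 = p *+ 2 *~ k.
  by rewrite -mulrzl -[RHS]mulrzl -mulrA; congr (_ * _); field.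
exact: half.
Qed.

Lemma noisy_state_reduced (theta : 'rV[R]_D) :
  noisy_state c E (\row_d reduced_angle (theta 0 d)) = noisy_state c E theta.
Proof.
rewrite /noisy_state /gate_channel.
suff -> : gate c (\row_d reduced_angle (theta 0 d)) = gate c theta by [].
by apply/funext => d; rewrite !gateE mxE pauli_rot_reduced.
Qed.

(** Reducing every parameter modulo 4 pi leaves the noisy state unchanged, so the extreme value
    theorem on a compact box covers all parameters. *)
Lemma nu_prob_attains_max Nh (H : observable R n Nh) y :
  exists theta0, forall theta,
    nu (prob H (noisy_state c E) y theta) <= nu (prob H (noisy_state c E) y theta0).
Proof.
pose A := [set theta : 'rV[R]_D | forall d, `[0, pi *+ 4]%classic (theta ord0 d)].
have [theta0 _ thetaM] : exists2 t0, t0 \in A & forall t, t \in A ->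
    nu (prob H (noisy_state c E) y t) <= nu (prob H (noisy_state c E) y t0).
  apply: EVT_max_rV.
  - by exists 0 => d /=; rewrite mxE in_itv /= lexx mulrn_wge0 ?pi_ge0.
  - apply: (@rV_compact _ _ (fun=> `[0, pi *+ 4]%classic)) => d.
    exact: segment_compact.
  - apply: continuous_subspaceT => theta.
    have pc : continuous (prob H (noisy_state c E) y).
      exact/expval_continuous/noisy_state_continuous.
    exact: (continuousM (pc theta) (continuousB (cvg_cst _) (pc theta))).
exists theta0 => theta.
rewrite -[leLHS]/(nu (expval _ _)) -noisy_state_reduced; apply: thetaM.
by rewrite inE => d /=; rewrite mxE in_itv /= reduced_angle_range.
Qed.

End ContinuityPeriodicity.

(** * Parameter-shift rule *)

Section ParameterShift.
Context {R : realType} {n D : nat} (c : circuit R n D).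
Notation C := R[i].
Implicit Types theta : 'rV[R]_D.
#[local] Opaque gate pauli_rot.

Lemma gate_shift_neq theta (s : R) d d' : d' != d ->
  gate c (theta + s *: delta_mx 0 d) d' = gate c theta d'.
Proof. by move=> dd; rewrite !gateE !mxE eqxx (negbTE dd) mulr0 addr0. Qed.

(** This is [pauli_rotD] with b = s/2; its shift of pi/2 in the half angle is a shift of pi in the
    parameter. *)
Lemma gate_shift theta (s : R) d :
  gate c (theta + s *: delta_mx 0 d) d =
  (cos (s / 2))%:C *: gate c theta d
  + (sin (s / 2))%:C *: gate c (theta + pi *: delta_mx 0 d) d.
Proof.
have entry (t : R) : (theta + t *: delta_mx 0 d) 0 d / 2 = theta 0 d / 2 + t / 2.
  by rewrite !mxE !eqxx mulr1 mulrDl.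
rewrite (gateE c (theta + s *: delta_mx 0 d)) (gateE c theta).
rewrite (gateE c (theta + pi *: delta_mx 0 d)) (entry s) (entry pi).
have lin (U V W : 'M[C]_(2 ^ n)) (x y : C) :
    (x *: U + y *: V) *m W = x *: (U *m W) + y *: (V *m W).
  by rewrite mulmxDl -!scalemxAl.
by rewrite (pauli_rotD _ _ (s / 2)) lin.
Qed.

Lemma foldl_mulmx_eq m p (W W' : 'I_D -> 'M[C]_m) (ds : seq 'I_D) (v : 'M[C]_(m, p)) :
  {in ds, W =1 W'} ->
  foldl (fun v d => W d *m v) v ds = foldl (fun v d => W' d *m v) v ds.
Proof.
elim: ds v => [//|d ds IH] v eqW /=.
rewrite eqW ?mem_head // IH // => d' d'ds; apply: eqW.
by rewrite inE d'ds orbT.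
Qed.

Lemma foldl_mulmx_linear m p (W : 'I_D -> 'M[C]_m) (ds : seq 'I_D) (a b : C)
    (u v : 'M[C]_(m, p)) :
  foldl (fun v d => W d *m v) (a *: u + b *: v) ds =
  a *: foldl (fun v d => W d *m v) u ds + b *: foldl (fun v d => W d *m v) v ds.
Proof.
elim: ds u v => [//|d ds IH] u v /=.
by rewrite mulmxDr -!scalemxAr IH.
Qed.

(** A product of matrices is linear in the factor at [d], which occurs exactly once: the products
    agree before [d], split there, and stay linear afterwards. *)
Lemma foldl_mulmx_combine m p (W W1 W2 : 'I_D -> 'M[C]_m) (a b : C) d
    (ds : seq 'I_D) (v : 'M[C]_(m, p)) : uniq ds -> d \in ds ->
  W d = a *: W1 d + b *: W2 d ->
  (forall e, e != d -> W e = W1 e) -> (forall e, e != d -> W2 e = W1 e) ->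
  foldl (fun v e => W e *m v) v ds =
  a *: foldl (fun v e => W1 e *m v) v ds + b *: foldl (fun v e => W2 e *m v) v ds.
Proof.
move=> uds dds Wd W1E W2E; case/splitPr: dds uds => l1 l2.
rewrite cat_uniq /= => /and3P[_ /norP[dl1 _] /andP[dl2 _]].
have eqW V V' (l : seq 'I_D) (v' : 'M[C]_(m, p)) :
    (forall e, e != d -> V e = V' e) -> d \notin l ->
    foldl (fun v e => V e *m v) v' l = foldl (fun v e => V' e *m v) v' l.
  move=> VE dl; apply: foldl_mulmx_eq => e el; apply: VE.
  by apply: contraNneq dl => <-.
rewrite !foldl_cat /=.
rewrite (eqW W W1 l1 v) // (eqW W2 W1 l1 v) // (eqW W W1 l2) // (eqW W2 W1 l2) //.
by rewrite Wd mulmxDl -!scalemxAl foldl_mulmx_linear.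
Qed.

Lemma psi_shift theta (s : R) d :
  psi c (theta + s *: delta_mx 0 d) =
  (cos (s / 2))%:C *: psi c theta
  + (sin (s / 2))%:C *: psi c (theta + pi *: delta_mx 0 d).
Proof.
apply: (@foldl_mulmx_combine _ _ (gate c _) (gate c _) (gate c _) _ _ d).
- exact: enum_uniq.
- by rewrite mem_enum.
- exact: gate_shift.
- by move=> e ed; apply: gate_shift_neq.
- by move=> e ed; apply: gate_shift_neq.
Qed.

Lemma expval_outer_combine m (A : 'M[C]_m) (u w : 'cV[C]_m) (a b : R) :
  expval A ((a%:C *: u + b%:C *: w) *m (a%:C *: u + b%:C *: w) ^t*) =
  a ^+ 2 * expval A (u *m u ^t*)
  + a * b * (expval A (u *m w ^t*) + expval A (w *m u ^t*))
  + b ^+ 2 * expval A (w *m w ^t*).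
Proof.
have lin (U V : 'M[C]_m) : expval A (a%:C *: U + b%:C *: V) =
    a * expval A U + b * expval A V.
  by rewrite expvalD (expvalZ _ U) (expvalZ _ V).
have linl (x : 'rV[C]_m) : (a%:C *: u + b%:C *: w) *m x =
    a%:C *: (u *m x) + b%:C *: (w *m x).
  by rewrite mulmxDl (scalemxAl _ u) (scalemxAl _ w).
have linr (x : 'cV[C]_m) : x *m (a%:C *: u + b%:C *: w) ^t* =
    a%:C *: (x *m u ^t*) + b%:C *: (x *m w ^t*).
  by rewrite adjD !adjZ !conjC_real mulmxDr (scalemxAr _ x) (scalemxAr _ x).
rewrite linl (linr u) (linr w) !lin.
move: (expval A (u *m u ^t*)) (expval A (u *m w ^t*)) => x y.
move: (expval A (w *m u ^t*)) (expval A (w *m w ^t*)) => z t; ring.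
Qed.

(** By [psi_shift] the loss is a quadratic form in cos(s/2) and sin(s/2); the double-angle formulas
    make it a trigonometric polynomial of degree one in s. *)
Lemma loss_shift Nh (H : observable R n Nh) theta d :
  exists a b g : R, forall s,
    loss c H (theta + s *: delta_mx 0 d) = a + b * cos s + g * sin s.
Proof.
have half (x y z s : R) :
    cos (s / 2) ^+ 2 * x + cos (s / 2) * sin (s / 2) * y + sin (s / 2) ^+ 2 * z =
    (x + z) / 2 + (x - z) / 2 * cos s + y / 2 * sin s.
  have -> : cos s = cos (s / 2) ^+ 2 - sin (s / 2) ^+ 2.
    by rewrite {1}[s]splitr cosD -!expr2.
  have -> : sin s = 2 * (cos (s / 2) * sin (s / 2)) by rewrite {1}[s]splitr sinD; ring.
  by rewrite cos2sin2; field.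
pose q (x y : 'cV[C]_(2 ^ n)) := expval (obs_mx H) (x *m y ^t*).
pose u := psi c theta; pose w := psi c (theta + pi *: delta_mx 0 d).
exists ((q u u + q w w) / 2), ((q u u - q w w) / 2), ((q u w + q w u) / 2) => s.
rewrite -half -expval_outer_combine -psi_shift.
by [].
Qed.

(** For f(s) = a + b cos s + g sin s, both f'(0) and (f(pi/2) - f(-pi/2))/2 equal g. *)
Lemma parameter_shift Nh (H : observable R n Nh) theta d :
  gradient (loss c H) theta 0 d =
  (loss c H (shift_param theta d true) - loss c H (shift_param theta d false)) / 2.
Proof.
have [a [b [g lossE]]] := loss_shift H theta d.
rewrite /shift_param !lossE mul1r mulN1r cosN sinN cos_pihalf sin_pihalf mxE.
pose f s := a + b * cos s + g * sin s.
have quotE : (fun h => h^-1 *: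
      ((loss c H \o shift theta) (h *: delta_mx 0 d) - loss c H theta))
    = (fun h => h^-1 *: ((f \o shift 0) (h *: (1 : R)) - f 0)).
  have loss0 : loss c H theta = f 0.
    by have := lossE 0; rewrite scale0r addr0.
  apply/funext => h; rewrite loss0 /shift /= addr0 [_ + theta]addrC lossE.
  by rewrite /f [h *: _]mulr1.
transitivity ('D_1 f 0); first by rewrite /derive quotE.
have -> : f = cst a + b \*: cos + g \*: sin by [].
rewrite derive_val cos0 sin0 oppr0 scaler0 !add0r [g *: _]mulr1; lra.
Qed.

End ParameterShift.

(** * Almost surely finitely-valued random variables *)

Section FiniteRandomVariables.
Context {R : realType} {disp : measure_display} {T : measurableType disp}.
Context (P : probability T R).
Implicit Types f g U V : T -> R.

Lemma ae_indicator_sum I (r : seq I) (a : I -> R) (A : I -> set T) f :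
  (forall i, measurable (A i)) -> measurable_fun setT f ->
  {ae P, forall x, f x = \sum_(i <- r) a i * \1_(A i) x} ->
  P.-integrable setT (EFin \o f) /\
  'E_P[f]%E = (\sum_(i <- r) a i * fine (P (A i)))%:E.
Proof.
move=> mA mf fE; pose g (x : T) := (\sum_(i <- r) (a i)%:E * (\1_(A i) x)%:E)%E.
have ig : P.-integrable setT g.
  apply: integrable_sum => // i _; apply: integrableZl => //.
  exact: integrable_indic.
have mEf : measurable_fun setT (EFin \o f) by exact/measurable_EFinP.
have fg : ae_eq P setT (EFin \o f) g.
  by apply: filterS fE => x fx _; rewrite /g /= fx -sumEFin.
have mg := measurable_int P ig.
split.
  apply/integrableP; split => //.
  rewrite (ae_eq_integral (abse \o g)) //.
  - by case/integrableP: ig.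
  - exact: measurableT_comp.
  - exact: measurableT_comp.
  - by apply: filterS fg => x fx _ /=; rewrite -fx.
rewrite unlock (ae_eq_integral g) // integral_sum //; last first.
  by move=> i; apply: integrableZl => //; exact: integrable_indic.
rewrite -sumEFin; apply: eq_bigr => i _.
rewrite integralZl //; last exact: integrable_indic.
by rewrite integral_indic // setIT EFinM fineK ?fin_num_measure.
Qed.

(** Outcome probabilities fix the values only up to a null set, hence the almost-sure form. The
    class is closed under sums and products, so every expectation below is a finite sum and
    integrability is automatic. *)
Definition ae_finite f :=
  measurable_fun setT f /\ exists s : seq R, {ae P, forall x, f x \in s}.

Lemma ae_finite_cst (a : R) : ae_finite (fun=> a).
Proof.
split; first exact: measurable_cst.
by exists [:: a]; apply: aeW => x; rewrite mem_head.
Qed.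

Lemma ae_finiteD f g : ae_finite f -> ae_finite g -> ae_finite (fun x => f x + g x).
Proof.
move=> [mf [s fs]] [mg [t gt]]; split; first exact: measurable_funD.
by exists [seq a + b | a <- s, b <- t]; apply: filterS2 fs gt => x; exact: allpairs_f.
Qed.

Lemma ae_finiteM f g : ae_finite f -> ae_finite g -> ae_finite (fun x => f x * g x).
Proof.
move=> [mf [s fs]] [mg [t gt]]; split; first exact: measurable_funM.
by exists [seq a * b | a <- s, b <- t]; apply: filterS2 fs gt => x; exact: allpairs_f.
Qed.

Lemma ae_finite_sum I (r : seq I) (F : I -> T -> R) :
  (forall i, ae_finite (F i)) -> ae_finite (fun x => \sum_(i <- r) F i x).
Proof.
move=> fF; elim: r => [|i r IH].
  by under eq_fun do rewrite big_nil; exact: ae_finite_cst.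
by under eq_fun do rewrite big_cons; exact: ae_finiteD.
Qed.

Lemma indicator_sum (s : seq R) f x : uniq s -> f x \in s ->
  f x = \sum_(a <- s) a * \1_(f @^-1` [set a]) x.
Proof.
move=> us fxs; rewrite (bigD1_seq (f x)) //= big1 => [|a af].
  by rewrite indicE mem_set // mulr1 addr0.
by rewrite indicE memNset ?mulr0 //= => fa; rewrite fa eqxx in af.
Qed.

Lemma measurable_level f (a : R) : measurable_fun setT f -> measurable (f @^-1` [set a]).
Proof. by move=> mf; rewrite -[X in measurable X]setTI; exact: mf. Qed.

Lemma ae_finite_indicator_sum f : ae_finite f -> exists s : seq R, uniq s /\
  {ae P, forall x, f x = \sum_(a <- s) a * \1_(f @^-1` [set a]) x}.
Proof.
move=> [_ [s fs]]; exists (undup s); split; first exact: undup_uniq.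
by apply: filterS fs => x fx; apply: indicator_sum; rewrite ?undup_uniq ?mem_undup.
Qed.

Lemma ae_finite_integrable f : ae_finite f -> P.-integrable setT (EFin \o f).
Proof.
move=> ff; have [s [_ fE]] := ae_finite_indicator_sum ff.
by have [] := ae_indicator_sum (fun a => measurable_level a ff.1) ff.1 fE.
Qed.

Definition mean f : R := fine 'E_P[f]%E.

Lemma meanE f : ae_finite f -> 'E_P[f]%E = (mean f)%:E.
Proof.
move=> ff; rewrite /mean fineK // unlock.
exact: integrable_fin_num (ae_finite_integrable ff).
Qed.

Lemma mean_cst (a : R) : mean (fun=> a) = a.
Proof. by rewrite /mean (expectation_cst P a). Qed.

Lemma meanD f g : ae_finite f -> ae_finite g ->
  mean (fun x => f x + g x) = mean f + mean g.
Proof.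
move=> ff fg; apply: EFin_inj.
rewrite EFinD -(meanE ff) -(meanE fg) -(meanE (ae_finiteD ff fg)) unlock.
by rewrite -integralD_EFin //; exact: ae_finite_integrable.
Qed.

Lemma meanZ (k : R) f : ae_finite f -> mean (fun x => k * f x) = k * mean f.
Proof.
move=> ff; apply: EFin_inj.
rewrite EFinM -(meanE ff) -(meanE (ae_finiteM (ae_finite_cst k) ff)) unlock.
by rewrite -integralZl //; exact: ae_finite_integrable.
Qed.

Lemma mean_sum I (r : seq I) (F : I -> T -> R) : (forall i, ae_finite (F i)) ->
  mean (fun x => \sum_(i <- r) F i x) = \sum_(i <- r) mean (F i).
Proof.
move=> fF; elim: r => [|i r IH].
  by under [X in mean X]eq_fun do rewrite big_nil; rewrite mean_cst big_nil.
under [X in mean X]eq_fun do rewrite big_cons.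
by rewrite meanD ?IH ?big_cons //; exact: ae_finite_sum.
Qed.

Definition independent_pair U V := forall A B : set R,
  measurable A -> measurable B ->
  P (U @^-1` A `&` V @^-1` B) = (P (U @^-1` A) * P (V @^-1` B))%E.

(** Expand both variables over their level sets; independence factors the probability of each
    intersection. *)
Lemma mean_independentM U V : ae_finite U -> ae_finite V -> independent_pair U V ->
  mean (fun x => U x * V x) = mean U * mean V.
Proof.
move=> fU fV indUV.
have [s [us UE]] := ae_finite_indicator_sum fU.
have [t [ut VE]] := ae_finite_indicator_sum fV.
have [_ EU] := ae_indicator_sum (fun a => measurable_level a fU.1) fU.1 UE.
have [_ EV] := ae_indicator_sum (fun a => measurable_level a fV.1) fV.1 VE.
have mUV (p : R * R) : measurable (U @^-1` [set p.1] `&` V @^-1` [set p.2]).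
  by apply: measurableI; apply: measurable_level; [exact: fU.1|exact: fV.1].
have [|_ EUV] := @ae_indicator_sum _ [seq (a, b) | a <- s, b <- t]
    (fun p => p.1 * p.2) _ _ mUV (ae_finiteM fU fV).1.
  apply: filterS2 UE VE => x {1}-> {1}->.
  rewrite big_allpairs big_distrlr /=; apply: eq_bigr => a _; apply: eq_bigr => b _.
  by rewrite indicI /= mulrACA.
rewrite /mean EU EV EUV /= big_allpairs big_distrlr /=.
apply: eq_bigr => a _; apply: eq_bigr => b _.
rewrite (indUV _ _ (measurable_set1 a) (measurable_set1 b)) fineM; first exact: mulrACA.
  by rewrite fin_num_measure //; apply: measurable_level; exact: fU.1.
by rewrite fin_num_measure //; apply: measurable_level; exact: fV.1.
Qed.

Lemma mean_centered f : ae_finite f -> mean (fun x => f x - mean f) = 0.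
Proof.
by move=> ff; rewrite meanD ?mean_cst ?subrr //; exact: ae_finite_cst.
Qed.

Lemma mean_centeredM U V : ae_finite U -> ae_finite V -> independent_pair U V ->
  mean (fun x => (U x - mean U) * (V x - mean V)) = 0.
Proof.
move=> fU fV indUV; rewrite mean_independentM ?mean_centered ?mul0r //.
- exact/ae_finiteD/ae_finite_cst.
- exact/ae_finiteD/ae_finite_cst.
move=> A B mA mB.
(* Centering is a measurable map, so independence passes to the centered variables. *)
have sh (W : T -> R) m (A' : set R) :
  (fun x => W x - m) @^-1` A' = W @^-1` ((fun x => x - m) @^-1` A') by [].
have msh m (A' : set R) : measurable A' -> measurable ((fun x : R => x - m) @^-1` A').
  move=> mA'; rewrite -[X in measurable X]setTI.
  have mf : measurable_fun setT (fun x : R => x - m).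
    by apply: measurable_funB; [exact: measurable_id|exact: measurable_cst].
  exact: mf.
by rewrite !sh indUV //; exact: msh.
Qed.

Lemma mutually_independent_pair (I : finType) (X : I -> T -> R) (i j : I) :
  i != j -> mutually_independent P X -> independent_pair (X i) (X j).
Proof.
move=> ij indX A B mA mB.
(* Independence is applied to the two-element index set, with [A] at [i] and [B] at [j]. *)
have := indX [set i; j]%SET (fun k => if k == i then A else B).
rewrite (bigD1 i) ?inE ?eqxx //= (big_pred1 j) => [|k]; last first.
  rewrite !inE; case: (eqVneq k i) => [->|ki] /=; first by rewrite (negbTE ij).
  by rewrite andbT.
rewrite eq_sym (negbTE ij) => <-; last by move=> k; case: ifP.
congr (P _); apply/seteqP; split=> x /=.
  move=> [Ax Bx] k /=; rewrite !inE; case/orP => /eqP ->; rewrite ?eqxx //.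
  by rewrite eq_sym (negbTE ij).
move=> h; split; first by have := h i; rewrite /= !inE eqxx; exact.
by have := h j; rewrite /= !inE eqxx orbT eq_sym (negbTE ij); exact.
Qed.

Section Discrete.
Context {Nh : nat} (h p : 'I_Nh -> R) (h_inj : injective h) (p_sum : \sum_y p y = 1).
Context (X : T -> R) (mX : measurable_fun setT X).
Context (Xp : forall y, P (X @^-1` [set h y]) = (p y)%:E).

(** The level sets at the [h y] are disjoint, as [h] is injective, and their probabilities sum to
    1. *)
Lemma discrete_ae : {ae P, forall x, exists y, X x = h y}.
Proof.
pose A := \big[setU/set0]_(y < Nh) (X @^-1` [set h y]).
have mA : measurable A.
  by apply: bigsetU_measurable => y _; exact: measurable_level.
have PA : P A = 1%E.
  rewrite /A measure_bigsetU_ord //=.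
  - by rewrite (eq_bigr (fun y => (p y)%:E)) // sumEFin p_sum.
  - by move=> y; exact: measurable_level.
  - by move=> y z _ _ [x [/= -> /h_inj]].
exists (~` A); split; first exact: measurableC.
  by rewrite probability_setC // PA subee.
move=> x /= nx Ax; apply: nx; move: Ax.
by rewrite /A -bigcup_seq => -[y _ /= ->]; exists y.
Qed.

Lemma discrete_finite : ae_finite X.
Proof.
split=> //; exists (map h (enum 'I_Nh)).
by apply: filterS discrete_ae => x [y ->]; rewrite map_f ?mem_enum.
Qed.

Lemma discrete_mean (g : R -> R) : measurable_fun setT (g \o X) ->
  mean (g \o X) = \sum_y g (h y) * p y.
Proof.
move=> mg.
have [|_ Eg] := @ae_indicator_sum _ (index_enum 'I_Nh) (g \o h) _ _
   (fun y => measurable_level (h y) mX) mg.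
  apply: filterS discrete_ae => x [y Xy].
  rewrite (bigD1 y) //= big1 => [|z zy].
    by rewrite indicE mem_set // mulr1 addr0 Xy.
  rewrite indicE memNset ?mulr0 //= Xy => /h_inj yz.
  by rewrite yz eqxx in zy.
by rewrite /mean Eg /=; apply: eq_bigr => y _; rewrite Xp.
Qed.

End Discrete.

End FiniteRandomVariables.

(** * Mean and variance of an empirical average *)

Section EmpiricalMean.
Context {R : realType} {disp : measure_display} {T : measurableType disp}.
Context (P : probability T R) {Nm : nat} (Nm_gt0 : (0 < Nm)%N).
Context (X : 'I_Nm -> T -> R) (m v : R).
Context (fX : forall k, ae_finite P (X k)).
Context (mX : forall k, mean P (X k) = m).
Context (vX : forall k, mean P (fun w => (X k w - m) ^+ 2) = v).
Context (indX : mutually_independent P X).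

Let Nm_neq0 : Nm%:R != 0 :> R.
Proof. by rewrite pnatr_eq0 -lt0n. Qed.

Lemma emp_mean_finite : ae_finite P (emp_mean X).
Proof. exact: ae_finiteM (ae_finite_sum _ fX) (ae_finite_cst _ _). Qed.

Lemma mean_emp_mean : mean P (emp_mean X) = m.
Proof.
have -> : emp_mean X = (fun w => Nm%:R^-1 * \sum_k X k w).
  by apply/funext => w; rewrite /emp_mean mulrC.
rewrite meanZ ?mean_sum //; last exact: ae_finite_sum.
by rewrite (eq_bigr (fun=> m)) // sumr_const card_ord -(mulr_natl m) mulKf.
Qed.

(** In the expanded square the off-diagonal terms vanish by independence, leaving N_m terms [v] over
    N_m^2. *)
Lemma variance_emp_mean : mean P (fun w => (emp_mean X w - m) ^+ 2) = v / Nm%:R.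
Proof.
pose Y k w := X k w - m.
have fY k : ae_finite P (Y k) by exact: ae_finiteD (fX k) (ae_finite_cst _ _).
have fYY k l : ae_finite P (fun w => Y k w * Y l w) by exact: ae_finiteM.
have -> : (fun w => (emp_mean X w - m) ^+ 2) =
    (fun w => Nm%:R^-1 ^+ 2 * \sum_k \sum_l Y k w * Y l w).
  apply/funext => w; have -> : emp_mean X w - m = Nm%:R^-1 * \sum_k Y k w.
    by rewrite /Y sumrB sumr_const card_ord -(mulr_natl m) mulrBr mulKf // mulrC.
  by rewrite exprMn (expr2 (\sum_k _)) big_distrlr.
rewrite meanZ; last by do 2!apply: ae_finite_sum => ?; exact: fYY.
rewrite mean_sum; last by move=> k; apply: ae_finite_sum => l; exact: fYY.
rewrite (eq_bigr (fun=> v)) => [|k _].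
  by rewrite sumr_const card_ord -mulr_natr; field.
rewrite mean_sum; last by move=> l; exact: fYY.
rewrite (bigD1 k) //= big1 ?addr0 => [|l lk].
  by rewrite -(vX k); congr mean; apply/funext => w; rewrite expr2.
rewrite /Y -{1}(mX k) -(mX l); apply: mean_centeredM => //.
by apply: mutually_independent_pair => //; rewrite eq_sym.
Qed.

End EmpiricalMean.

(** * Variance bound for a finite distribution *)

Section DiscreteVariance.
Context {R : realType} {N : nat} (h p : 'I_N -> R).
Context (p_sum : \sum_y p y = 1).
Context (p_ge0 : forall y, 0 <= p y).

(** Half the double sum of (a_y - a_z)^2 is exactly the difference of the two sides. *)
Lemma sqr_sum_le (a : 'I_N -> R) : (\sum_y a y) ^+ 2 <= N%:R * \sum_y a y ^+ 2.
Proof.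
have : 0 <= \sum_y \sum_z (a y - a z) ^+ 2.
  by apply: sumr_ge0 => y _; apply: sumr_ge0 => z _; exact: sqr_ge0.
have -> : \sum_y \sum_z (a y - a z) ^+ 2 =
    2 * (N%:R * \sum_y a y ^+ 2) - 2 * (\sum_y a y) ^+ 2.
  rewrite (eq_bigr (fun y => N%:R * a y ^+ 2 - 2 * (a y * \sum_z a z)
      + \sum_z a z ^+ 2)) => [|y _].
    rewrite big_split /= sumrB -!mulr_sumr -mulr_suml sumr_const card_ord.
    by rewrite -(mulr_natl (\sum_z _)) expr2; ring.
  rewrite (eq_bigr (fun z => a y ^+ 2 - 2 * (a y * a z) + a z ^+ 2)) => [|z _].
    by rewrite big_split /= sumrB sumr_const card_ord -(mulr_natl (_ ^+ 2)) -!mulr_sumr.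
  by ring.
lra.
Qed.

(* [h z - mu = sum_y h y (delta_(y z) - p y)], to which Cauchy-Schwarz applies;
   the indicator of outcome y has variance [nu (p y)]. *)
Lemma discrete_variance_le :
  \sum_z (h z - \sum_y h y * p y) ^+ 2 * p z <= N%:R * \sum_y h y ^+ 2 * nu (p y).
Proof.
pose dl (y z : 'I_N) : R := (y == z)%:R.
have dlE z : h z - \sum_y h y * p y = \sum_y h y * (dl y z - p y).
  under [RHS]eq_bigr do rewrite mulrBr.
  rewrite sumrB; congr (_ - _); rewrite (bigD1 z) //= /dl eqxx mulr1.
  by rewrite big1 ?addr0 // => y /negbTE ->; rewrite mulr0.
have var y : \sum_z (dl y z - p y) ^+ 2 * p z = nu (p y).
  rewrite (bigD1 y) //= {1}/dl eqxx (eq_bigr (fun z => p y ^+ 2 * p z)) => [|z zy].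
    have : \sum_(z | z != y) p z = 1 - p y.
      by rewrite -p_sum [in RHS](bigD1 y) //= (addrC (p y)) addrK.
    by rewrite -mulr_sumr => ->; rewrite /nu -[true%:R]/(1 : R); ring.
  by rewrite /dl eq_sym (negbTE zy) sub0r sqrrN.
rewrite mulr_sumr; under [leRHS]eq_bigr => y _ do rewrite -var mulr_sumr mulr_sumr.
rewrite exchange_big /=; apply: ler_sum => z _; rewrite dlE.
under [leRHS]eq_bigr => y _ do rewrite mulrA mulrA.
rewrite -mulr_suml ler_wpM2r //; apply: le_trans (sqr_sum_le _) _.
by rewrite mulr_sumr; apply: ler_sum => y _; rewrite exprMn mulrA.
Qed.

End DiscreteVariance.

(** * Half the difference of two independent variables *)

Section HalfDifference.
Context {R : realType} {disp : measure_display} {T : measurableType disp}.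
Context (P : probability T R) (U V : T -> R).
Context (fU : ae_finite P U) (fV : ae_finite P V).

Lemma ae_finite_half_diff : ae_finite P (fun w => (U w - V w) / 2).
Proof.
have -> : (fun w => (U w - V w) / 2) = (fun w => (U w + (-1) * V w) * 2^-1).
  by apply/funext => w; rewrite mulN1r.
apply: ae_finiteM (ae_finite_cst _ _); apply: ae_finiteD => //.
exact: ae_finiteM (ae_finite_cst _ _) fV.
Qed.

Lemma mean_half_diff : mean P (fun w => (U w - V w) / 2) = (mean P U - mean P V) / 2.
Proof.
have -> : (fun w => (U w - V w) / 2) = (fun w => 2^-1 * (U w + (-1) * V w)).
  by apply/funext => w; rewrite mulN1r mulrC.
have fNV : ae_finite P (fun w => -1 * V w) by exact: ae_finiteM (ae_finite_cst _ _) fV.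
by rewrite meanZ ?meanD ?meanZ //; [rewrite mulN1r mulrC|exact: ae_finiteD].
Qed.

Lemma variance_half_diff : independent_pair P U V ->
  mean P (fun w => ((U w - V w) / 2 - (mean P U - mean P V) / 2) ^+ 2) =
  (mean P (fun w => (U w - mean P U) ^+ 2)
   + mean P (fun w => (V w - mean P V) ^+ 2)) / 4.
Proof.
move=> indUV; pose a w := U w - mean P U; pose b w := V w - mean P V.
have fa : ae_finite P a by exact: ae_finiteD fU (ae_finite_cst _ _).
have fb : ae_finite P b by exact: ae_finiteD fV (ae_finite_cst _ _).
have faa : ae_finite P (fun w => a w ^+ 2) by exact: ae_finiteM.
have fbb : ae_finite P (fun w => b w ^+ 2) by exact: ae_finiteM.
have fab : ae_finite P (fun w => a w * b w) by exact: ae_finiteM.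
have -> : (fun w => ((U w - V w) / 2 - (mean P U - mean P V) / 2) ^+ 2) =
    (fun w => 4^-1 * (a w ^+ 2 + b w ^+ 2) + - 2^-1 * (a w * b w)).
  by apply/funext => w; rewrite /a /b; field.
have ab0 : mean P (fun w => a w * b w) = 0 by exact: mean_centeredM.
have fs : ae_finite P (fun w => a w ^+ 2 + b w ^+ 2) by exact: ae_finiteD.
rewrite (meanD (ae_finiteM (ae_finite_cst _ _) fs) (ae_finiteM (ae_finite_cst _ _) fab)).
by rewrite (meanZ _ fs) (meanZ _ fab) (meanD faa fbb) ab0 mulr0 addr0 mulrC.
Qed.

End HalfDifference.

(** * Gradient estimator *)

Section GradientEstimator.
Context {R : realType} {n D Nh Nm : nat} (D_gt0 : (0 < D)%N) (Nm_gt0 : (0 < Nm)%N).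
Context (c : circuit R n D) (E : pauli_noise R n) (H : observable R n Nh).
Context (theta : 'rV[R]_D).
Context {disp : measure_display} {T : measurableType disp} (P : probability T R).
Context (X : 'I_D -> bool -> 'I_Nm -> {RV P >-> R}).
Context (XP : measurement_outcomes c E H theta X).

Let p d b y := prob H (noisy_state c E) y (shift_param theta d b).
Let mu d b := expval (obs_mx H) (noisy_state c E (shift_param theta d b)).
Let M d b := emp_mean (fun k => X d b k).

Lemma nu_le_quarter (x : R) : nu x <= 4^-1.
Proof. by have := sqr_ge0 (x - 2^-1); rewrite /nu; lra. Qed.

(** The bound 1/4 on [nu] makes both nested suprema run over bounded sets. *)
Lemma nu_prob_le_cgamma y t : nu (prob H (noisy_state c E) y t) <= cgamma c E H.
Proof.
pose S z := [set nu (prob H (noisy_state c E) z s) | s in [set: 'rV[R]_D]].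
have S_ub z : ubound (S z) 4^-1 by move=> _ [s _ <-]; exact: nu_le_quarter.
apply: (@le_trans _ _ (sup (S y))).
  by apply: ub_le_sup; [exists 4^-1|exists t].
apply: ub_le_sup; last by exists y.
exists 4^-1 => _ [z _ <-]; apply: ge_sup.
  by exists (nu (prob H (noisy_state c E) z 0)); exists 0.
exact: S_ub.
Qed.

Lemma cgamma_ge0 : 0 <= cgamma c E H.
Proof.
(* Probabilities summing to 1 guarantee at least one outcome, whose [nu] is a nonnegative lower
   bound. *)
have := sum_prob c E H theta; case: (pickP 'I_Nh) => [y _ _|no]; last first.
  by rewrite big_pred0 // => /eqP; rewrite eq_sym oner_eq0.
apply: le_trans (nu_prob_le_cgamma y theta).
have /andP[p0 p1] := prob_range c E H y theta.
by rewrite mulr_ge0 // subr_ge0.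
Qed.

Lemma outcome_finite d b k : ae_finite P (X d b k).
Proof.
case: XP => Xp _ _.
exact: (discrete_finite (@outcome_inj _ _ _ H) (sum_prob c E H _)
  (@measurable_funPT _ _ _ _ _) (Xp d b k)).
Qed.

Lemma mean_outcome d b k : mean P (X d b k) = mu d b.
Proof.
case: XP => Xp _ _.
have := discrete_mean (@outcome_inj _ _ _ H) (sum_prob c E H _)
  (@measurable_funPT _ _ _ _ (X d b k)) (Xp d b k) (g := idfun)
  (@measurable_funPT _ _ _ _ (X d b k)).
by rewrite /mu expval_obs => <-.
Qed.

Lemma variance_outcome d b k : mean P (fun w => (X d b k w - mu d b) ^+ 2) =
  \sum_y (outcome H y - mu d b) ^+ 2 * p d b y.
Proof.
case: XP => Xp _ _.
have mg : measurable_fun setT ((fun x => (x - mu d b) ^+ 2) \o X d b k).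
  apply: measurable_funX; apply: measurable_funB; last exact: measurable_cst.
  exact: measurable_funPT.
exact: (discrete_mean (@outcome_inj _ _ _ H) (sum_prob c E H _)
  (@measurable_funPT _ _ _ _ (X d b k)) (Xp d b k) mg).
Qed.

Lemma variance_outcome_le d b :
  \sum_y (outcome H y - mu d b) ^+ 2 * p d b y <=
  Nh%:R * complex.Re (\tr (obs_mx H *m obs_mx H)) * cgamma c E H.
Proof.
rewrite /mu expval_obs; apply: le_trans (discrete_variance_le _ _ _) _.
- exact: sum_prob.
- by move=> y; have /andP[] := prob_range c E H y (shift_param theta d b).
rewrite -!mulrA ler_wpM2l // ?ler0n //.
apply: (@le_trans _ _ ((\sum_y outcome H y ^+ 2) * cgamma c E H)).
  rewrite mulr_suml; apply: ler_sum => y _.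
  by rewrite ler_wpM2l ?sqr_ge0 // nu_prob_le_cgamma.
by rewrite ler_wpM2r ?cgamma_ge0 // sum_sqr_outcome_le.
Qed.

Lemma finite_M d b : ae_finite P (M d b).
Proof. by apply: emp_mean_finite => k; exact: outcome_finite. Qed.

Lemma mean_M d b : mean P (M d b) = mu d b.
Proof.
by apply: mean_emp_mean => // k; [exact: outcome_finite|exact: mean_outcome].
Qed.

Lemma variance_M_le d b : mean P (fun w => (M d b w - mu d b) ^+ 2) <=
  Nh%:R * complex.Re (\tr (obs_mx H *m obs_mx H)) * cgamma c E H / Nm%:R.
Proof.
rewrite (@variance_emp_mean _ _ _ P _ _ _ (mu d b)
  (\sum_y (outcome H y - mu d b) ^+ 2 * p d b y)) //.
- by rewrite ler_wpM2r ?invr_ge0 ?ler0n // variance_outcome_le.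
- by move=> k; exact: outcome_finite.
- by move=> k; exact: mean_outcome.
- by move=> k; exact: variance_outcome.
- by case: XP.
Qed.

Lemma grad_est_entry d : (fun w => grad_est X w 0 d) =
  (fun w => (M d true w - M d false w) / 2).
Proof. by apply/funext => w; rewrite mxE. Qed.

Lemma mean_grad_est_entry d : mean_grad_est X 0 d = (mu d true - mu d false) / 2.
Proof.
rewrite mxE grad_est_entry -[LHS]/(mean P _) mean_half_diff ?mean_M //; exact: finite_M.
Qed.

Lemma xi_entry d : (fun w => xi X w 0 d ^+ 2) = (fun w =>
  ((M d true w - M d false w) / 2 - (mean P (M d true) - mean P (M d false)) / 2) ^+ 2).
Proof.
apply/funext => w; rewrite !mean_M -mean_grad_est_entry /xi mxE.
by rewrite [in LHS]mxE [X in _ + X]mxE.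
Qed.

Lemma xi_entry_finite d : ae_finite P (fun w => xi X w 0 d ^+ 2).
Proof.
rewrite xi_entry; apply: (ae_finiteM (f := fun w => _ - _) (g := fun w => _ - _));
  by apply: ae_finiteD (ae_finite_cst _ _); apply: ae_finite_half_diff; exact: finite_M.
Qed.

Lemma mean_xi_entry_le d : mean P (fun w => xi X w 0 d ^+ 2) <=
  Nh%:R * complex.Re (\tr (obs_mx H *m obs_mx H)) * cgamma c E H / Nm%:R / 2.
Proof.
rewrite xi_entry variance_half_diff; try exact: finite_M; last first.
  case: XP => _ _ indM.
  have nd : (d, true) != (d, false) by rewrite xpair_eqE andbF.
  exact: mutually_independent_pair nd indM.
(* Two independent averages, each scaled by 1/2, contribute a quarter of the sum of their variances;
   this gives the 2 in the denominator. *)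
have avg (x y b : R) : x <= b -> y <= b -> (x + y) / 4 <= b / 2 by lra.
by rewrite !mean_M; apply: avg; exact: variance_M_le.
Qed.

Lemma expectation_sqnorm_xi_le :
  ('E_P[fun w => sqnorm (xi X w)] <=
    (D%:R * Nh%:R * complex.Re (\tr (obs_mx H *m obs_mx H))
     / (2 * Nm%:R) * cgamma c E H)%:E)%E.
Proof.
rewrite meanE; last by apply: ae_finite_sum => d; exact: xi_entry_finite.
rewrite lee_fin mean_sum; last by move=> d; exact: xi_entry_finite.
apply: (@le_trans _ _ (\sum_(d < D)
    (Nh%:R * complex.Re (\tr (obs_mx H *m obs_mx H)) * cgamma c E H / Nm%:R / 2))).
  by apply: ler_sum => d _; exact: mean_xi_entry_le.
rewrite sumr_const card_ord -(mulr_natl (_ / 2)) le_eqVlt; apply/orP; left; apply/eqP.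
rewrite invfM; ring.
Qed.

Lemma sqnorm_bias_le :
  sqnorm (bias X c H theta) <= 4 * D%:R * opnorm (obs_mx H) ^+ 2 * gamma D E.
Proof.
have avg (x y z b : R) : x <= y + z -> y <= b -> z <= b -> x / 2 <= b by lra.
have /andP[g0 g1] := gamma_range (D := D) E.
set A := opnorm (obs_mx H).
have -> : 4 * D%:R * A ^+ 2 * gamma D E = \sum_(d < D) (4 * A ^+ 2 * gamma D E).
  by rewrite sumr_const card_ord -(mulr_natl (_ * gamma D E)); ring.
apply: ler_sum => d _.
have bd : `|bias X c H theta 0 d| <= 2 * A * gamma D E.
  (* By the parameter-shift rule the entry is half the difference of the noisy-minus-ideal errors at
     the two shifted points. *)
  have -> : bias X c H theta 0 d =
      ((mu d true - loss c H (shift_param theta d true))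
       - (mu d false - loss c H (shift_param theta d false))) / 2.
    have half (x y z t : R) : (x - y) / 2 - (z - t) / 2 = (x - z - (y - t)) / 2.
      by field.
    rewrite -half -mean_grad_est_entry -parameter_shift /bias [LHS]mxE.
    by rewrite [X in _ + X = _]mxE.
  have b1 := expval_noisy_error c E H (shift_param theta d true).
  have b0 := expval_noisy_error c E H (shift_param theta d false).
  rewrite normrM [`|2^-1|]ger0_norm ?invr_ge0 ?ler0n //.
  exact: avg (ler_normB _ _) b1 b0.
rewrite -(real_normK (num_real _)).
have sq : `|bias X c H theta 0 d| ^+ 2 <= (2 * A * gamma D E) ^+ 2.
  by rewrite lerXn2r ?nnegrE // (le_trans _ bd).
apply: le_trans sq _.
(* One factor gamma is dropped, being at most 1. *)
have -> : (2 * A * gamma D E) ^+ 2 = 4 * A ^+ 2 * gamma D E * gamma D E by ring.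
by rewrite ler_piMr // mulr_ge0 // mulr_ge0 // sqr_ge0.
Qed.

End GradientEstimator.

Theorem lemma4p1 (R : realType) (n D Nh Nm : nat) (D_gt0 : (0 < D)%N)
  (Nm_gt0 : (0 < Nm)%N) (c : circuit R n D) (E : pauli_noise R n)
  (H : observable R n Nh) (rhot : 'rV[R]_D -> 'M[R[i]]_(2 ^ n))
  (rhotP : error_density_matrix c E rhot) (thetat : 'rV[R]_D)
  (disp : measure_display) (T : measurableType disp) (P : probability T R)
  (X : 'I_D -> bool -> 'I_Nm -> {RV P >-> R})
  (XP : measurement_outcomes c E H thetat X) :
  [/\ (forall y : 'I_Nh, exists theta0 : 'rV[R]_D, forall theta : 'rV[R]_D,
         nu (prob H (noisy_state c E) y theta)
         <= nu (prob H (noisy_state c E) y theta0)),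
      ('E_P[fun w => sqnorm (xi X w)] <=
         (D%:R * Nh%:R * complex.Re (\tr (obs_mx H *m obs_mx H))
          / (2 * Nm%:R) * cgamma c E H)%:E)%E,
      (forall (y : 'I_Nh) (theta : 'rV[R]_D),
         nu (prob H (noisy_state c E) y theta) =
           gamma D E * nu (prob H rhot y theta)
           + nu (1 - gamma D E)
             * (prob H (pure_state c) y theta - prob H rhot y theta) ^+ 2
           + (1 - gamma D E) * nu (prob H (pure_state c) y theta))
    & sqnorm (bias X c H thetat) <=
        4 * D%:R * opnorm (obs_mx H) ^+ 2 * gamma D E].
Proof.
split.
(* For each of the finitely many outcomes the supremum over the parameters is attained, so [cgamma]
   is indeed a maximum. *)
- exact: nu_prob_attains_max.
- exact: (expectation_sqnorm_xi_le Nm_gt0 XP).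
- by move=> y theta; exact: (nu_prob_noisy H y theta D_gt0 rhotP).
- exact: (sqnorm_bias_le Nm_gt0 XP).
Qed.
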